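(* Let $\mathfrak G=\{G_i\}_{i\in I}$ be a family of finite abelian groups indexed by a finite set $I$. Then the quasiregular coherent configurations of type $\mathfrak G$ are in one-to-one correspondence with the amalgam configurations based on $\mathfrak G$. Moreover, this correspondence can be chosen so that a quasiregular coherent configuration of type $\mathfrak G$ is schurian if and only if the corresponding amalgam configuration admits an amalgam.
   Context: A coherent configuration is a pair $\mathcal X=(\Omega,S)$ where $\Omega$ is a finite set and $S$ is a partition of $\Omega\times\Omega$ (whose elements are called basis relations) such that the diagonal $1_\Omega$ is a union of basis relations, $s^*=\{(\beta,\alpha):(\alpha,\beta)\in s\}\in S$ for all $s\in S$, and for all $r,s,t\in S$ the number $|\alpha r\cap \beta s^*|$ does not depend on the choice of $(\alpha,\beta)\in t$, where $\alpha r=\{\beta:(\alpha,\beta)\in r\}$. A fiber is a set $\Delta\subseteq\Omega$ with $1_\Delta\in S$; $\Omega$ is the disjoint union of the fibers, and the homogeneous component on a fiber $\Delta$ is $(\Delta,S_\Delta)$ with $S_\Delta=\{s\in S: s\subseteq \Delta\times\Delta\}$. A relation $s$ is thin if $|\alpha s|\le 1$ and $|\alpha s^*|\le 1$ for all $\alpha$. A regular scheme is a coherent configuration with exactly one fiber all of whose basis relations are thin; its basis relations form a group under composition $r\cdot s=\{(\alpha,\beta):(\alpha,\gamma)\in r,(\gamma,\beta)\in s\text{ for some }\gamma\}$. A coherent configuration is quasiregular if each homogeneous component is a regular scheme; it is of type $\mathfrak G=\{G_i\}_{i\in I}$ if its fibers are indexed as $\Omega_i$, $i\in I$, and the group of basis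 relations of the homogeneous component on $\Omega_i$ is $G_i$ for each $i$. A coherent configuration $(\Omega,S)$ is schurian if $S$ is the set of orbits on $\Omega\times\Omega$ of some permutation group $K\le\mathrm{Sym}(\Omega)$. An amalgam configuration based on $\mathfrak G$ consists of subgroups $U_{ij}\le G_i$ ($i,j\in I$) with $U_{ii}=G_i$, and isomorphisms $f_{ij}:U_{ij}\to U_{ji}$ with $f_{ii}=\mathrm{id}$ and $f_{ij}f_{ji}=\mathrm{id}$, such that for all $i,j,k\in I$: $f_{ik}(U_{ij}\cap U_{ik})=U_{ki}\cap U_{kj}$, and the composite of the restrictions of $f_{ik}$, then $f_{kj}$, then $f_{ji}$ is the identity map of $U_{ij}\cap U_{ik}$. It admits an amalgam if, letting $U=\prod_{i\in I}G_i$ (direct product, each $G_i$ viewed as a factor), $U_0$ the subgroup of $U$ generated by all $x^{-1}f_{ij}(x)$ with $x\in U_{ij}$, $i,j\in I$, and $\pi:U\to U/U_0$ the canonical epimorphism, one has that $\pi$ is injective on each $G_i$ and $\pi(G_i)\cap\pi(G_j)=\pi(U_{ij})$ for all $i,j\in I$. *)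

(* Defs.v *)
From mathcomp Require Import all_boot all_fingroup.

Set Implicit Arguments.
Unset Strict Implicit.
Unset Printing Implicit Defensive.

Import GroupScope.

Section CoherentConfigurations.

Variable T : finType.
Implicit Types (Omega Delta : {set T}) (r s t : {set T * T}).
Implicit Types (S : {set {set T * T}}).

Definition diag_rel Omega : {set T * T} := [set (x, x) | x in Omega].

Definition conv_rel s : {set T * T} := [set (p.2, p.1) | p in s].

Definition nbrs s (x : T) : {set T} := [set y | (x, y) \in s].

Definition comp_rel r s : {set T * T} :=
  [set p | [exists z, ((p.1, z) \in r) && ((z, p.2) \in s)]].

(* The point set is a subset Omega of T, so that the homogeneous components
   of a configuration are again configurations over the same ambient type. *)
Record coherent Omega S : Prop := Coherent {
  coherent_partition : partition S (setX Omega Omega);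
  coherent_diag :
    exists D : {set {set T * T}}, D \subset S /\ diag_rel Omega = cover D;
  coherent_conv : forall s, s \in S -> conv_rel s \in S;
  coherent_intersection : forall r s t, r \in S -> s \in S -> t \in S ->
    forall p q, p \in t -> q \in t ->
      #|nbrs r p.1 :&: nbrs (conv_rel s) p.2| =
      #|nbrs r q.1 :&: nbrs (conv_rel s) q.2|
}.

Definition fibers S : {set {set T}} := [set Delta | diag_rel Delta \in S].

Definition hom_component S Delta : {set {set T * T}} :=
  [set s in S | s \subset setX Delta Delta].

Definition thin s : Prop :=
  forall x : T, #|nbrs s x| <= 1 /\ #|nbrs (conv_rel s) x| <= 1.

Definition regular_scheme Omega S : Prop :=
  [/\ coherent Omega S, #|fibers S| = 1%N & forall s, s \in S -> thin s].

Definition quasiregular S : Prop :=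
  coherent [set: T] S /\
  forall Delta, Delta \in fibers S ->
    regular_scheme Delta (hom_component S Delta).

Definition pair_orbit (K : {group {perm T}}) (p : T * T) : {set T * T} :=
  [set (k p.1, k p.2) | k : {perm T} in K].

Definition schurian S : Prop :=
  exists K : {group {perm T}}, S = [set pair_orbit K p | p : T * T].

End CoherentConfigurations.

Section Types.

Variables (I : finType) (G : I -> finGroupType).

(* The identification of G i with the group of basis relations of the
   homogeneous component on qcc_fiber i is part of the data: qcc_label i g is
   the basis relation named g. *)
Record qcc_of_type := QccOfType {
  qcc_point : finType;
  qcc_basis : {set {set qcc_point * qcc_point}};
  qcc_quasiregular : quasiregular qcc_basis;
  qcc_fiber : I -> {set qcc_point};
  qcc_fiber_inj : injective qcc_fiber;
  qcc_fiber_im : [set qcc_fiber i | i : I] = fibers qcc_basis;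
  qcc_label : forall i, G i -> {set qcc_point * qcc_point};
  qcc_label_inj : forall i, injective (@qcc_label i);
  qcc_label_im : forall i,
    [set qcc_label g | g : G i] = hom_component qcc_basis (qcc_fiber i);
  qcc_labelM : forall i (g h : G i),
    qcc_label (g * h) = comp_rel (qcc_label g) (qcc_label h)
}.

Definition map_rel (T T' : finType) (sigma : T -> T') (s : {set T * T}) :
  {set T' * T'} := [set (sigma p.1, sigma p.2) | p in s].

(* Isomorphisms respect the indexing of the fibers and the labels; dropping
   the labels would identify configurations differing by automorphisms of the
   G i, which belong to distinct amalgam configurations. *)
Definition qcc_iso (X Y : qcc_of_type) : Prop :=
  exists sigma : qcc_point X -> qcc_point Y,
    [/\ bijective sigma,
        [set map_rel sigma s | s in qcc_basis X] = qcc_basis Y,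
        forall i, sigma @: qcc_fiber X i = qcc_fiber Y i
      & forall i (g : G i),
          map_rel sigma (qcc_label X g) = qcc_label Y g].

Record amalgam_configuration := AmalgamConfiguration {
  am_U : forall i j : I, {group G i};
  am_f : forall i j : I, {morphism am_U i j >-> G j};
  am_isom : forall i j, isom (am_U i j) (am_U j i) (am_f i j);
  am_Uii : forall i, am_U i i = [set: G i] :> {set G i};
  am_fii : forall i, {in am_U i i, forall x, am_f i i x = x};
  am_fK : forall i j, {in am_U i j, forall x, am_f j i (am_f i j x) = x};
  am_cap : forall i j k,
    am_f i k @* (am_U i j :&: am_U i k) = am_U k i :&: am_U k j;
  am_cocycle : forall i j k, {in am_U i j :&: am_U i k,
    forall x, am_f j i (am_f k j (am_f i k x)) = x}
}.

(* Equality of amalgam configurations: the maps f_ij are compared only on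
   their domains U_ij, since their values elsewhere are meaningless. *)
Definition am_eq (A B : amalgam_configuration) : Prop :=
  forall i j, am_U A i j = am_U B i j /\ {in am_U A i j, am_f A i j =1 am_f B i j}.

Definition am_relators (A : amalgam_configuration) :
  {set {dffun forall i, G i}} :=
  \bigcup_(i : I) \bigcup_(j : I)
    [set (@dfung1 I G i x)^-1 * @dfung1 I G j (am_f A i j x) | x in am_U A i j].

Definition am_U0 (A : amalgam_configuration) :
  {group {dffun forall i, G i}} := <<am_relators A>>%G.

Definition am_pi (A : amalgam_configuration) (i : I) (x : G i) :
  coset_of (am_U0 A) := coset (am_U0 A) (dfung1 x).

(* When the G i are abelian, am_U0 A is normal in the direct product, so that
   coset (am_U0 A) is the canonical epimorphism on the whole product. *)
Definition admits_amalgam (A : amalgam_configuration) : Prop :=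
  (forall i, injective (@am_pi A i)) /\
  (forall i j, (@am_pi A i @: [set: G i]) :&: (@am_pi A j @: [set: G j]) =
               @am_pi A i @: am_U A i j).

End Types.

(* Main.v *)
(* Let G_i act on the fiber Omega_i on the right through the basis relations.
   Since G_i x G_j acts regularly on Omega_i x Omega_j and permutes the basis
   relations there, these are the cosets of a subgroup L_ij of G_i x G_j, and
   coherence amounts to L_ii being the diagonal, L_ji the transpose of L_ij and
   L_ij <= L_ik o L_kj.  Thus L_ij is the graph of an isomorphism between
   quotients of G_i and G_j.  Fixing a nondegenerate symmetric pairing on each
   G_i (Pontryagin duality), orthogonal complements M_ij = L_ij^perp turn this
   inclusion into M_ik o M_kj <= M_ij, which says exactly that the M_ij are the
   graphs of the isomorphisms f_ij : U_ij -> U_ji of an amalgam configuration.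
   A permutation group preserving the basis relations acts on each fiber as a
   subgroup of G_i; the largest one consists of the u in prod_i G_i such that
   (u_i, u_j) is in L_ij for all i, j: it is the orthogonal complement of U_0.  Schurity says that
   this group projects onto every L_ij, and dually that dfung1 x^-1 * dfung1 y
   lies in U_0 only when y = f_ij(x), which is the amalgam condition. *)
Require Import Defs.
From mathcomp Require Import all_boot all_fingroup.
From mathcomp Require Import all_order all_algebra all_solvable all_field.

Set Implicit Arguments.
Unset Strict Implicit.
Unset Printing Implicit Defensive.

Import GRing.Theory Num.Theory GroupScope.

(** * Nondegenerate pairings *)

(** On a group [A] the values are roots of unity, so such a pairing identifies [A] with its own
    character group; multiplicativity in the second argument follows by symmetry. *)
Record pairing (gT : finGroupType) (A : {set gT}) (b : gT -> gT -> algC) :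
  Prop := Pairing {
  pairingC : {in A &, forall x y, b x y = b y x};
  pairing1 : {in A, forall y, b 1 y = 1%R};
  pairingM : {in A & A & A, forall x x' y, b (x * x') y = (b x y * b x' y)%R};
  pairing_nondeg : {in A, forall x, {in A, forall y, b x y = 1%R} -> x = 1}
}.

(** With [z] a primitive root of unity of order [#[x]], the pairing sends [x ^+ m] and [x ^+ n] to
    [z ^+ (m * n)]. *)
Lemma pairing_cycle (gT : finGroupType) (x : gT) : {b | pairing <[x]> b}.
Proof.
have [z pz] := C_prim_root_exists (order_gt0 x).
(* Discrete logarithm to base [x]: on the cycle, the least exponent, which is found below [#[x]]. *)
pose l y := find (fun n => y == x ^+ n) (iota 0 #[x]).
have lP : {in <[x]>, forall y, y = x ^+ l y}.
  move=> y /cyclePmin[m ltm def_y].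
  have/(nth_find 0%N): has (fun n => y == x ^+ n) (iota 0 #[x]).
    by apply/hasP; exists m; rewrite ?mem_iota ?def_y.
  move/eqP; rewrite nth_iota ?add0n //.
  rewrite -[X in (_ < X)%N](size_iota 0 #[x]) -has_find.
  by apply/hasP; exists m; rewrite ?mem_iota ?def_y.
have lX n m : x ^+ n = x ^+ m -> (z ^+ n = z ^+ m)%R.
  move/eqP; rewrite eq_expg_mod_order => e.
  by apply/eqP; rewrite (eq_prim_root_expr pz).
exists (fun y y' => (z ^+ (l y * l y'))%R); split.
- by move=> y y' _ _; rewrite mulnC.
- move=> y _; rewrite exprM (lX _ 0%N) ?expr1n //.
  by rewrite -lP ?group1 ?expg0.
- move=> y y' y'' Ay Ay' _; rewrite !exprM -exprMn -exprD.
  by congr (_ ^+ _)%R; apply: lX; rewrite expgD -!lP ?groupM.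
(* Pairing with the generator gives [z ^+ l y = 1], so [#[x]] divides [l y]. *)
- move=> y Ay /(_ x (cycle_id x)); rewrite mulnC exprM (lX _ 1%N) -?lP
  ?cycle_id ?expg1 //.
  rewrite expr1 => /eqP; rewrite -(prim_order_dvd pz) => dv.
  by rewrite (lP _ Ay); apply/eqP; rewrite -order_dvdn.
Qed.

(** [divgr] and [remgr] are the components in [A] and [B], so this is the orthogonal sum of the two
    pairings. *)
Lemma pairing_dprod (gT : finGroupType) (A B G : {group gT}) bA bB :
    A \x B = G -> pairing A bA -> pairing B bB ->
  pairing G (fun x y => bA (divgr A B x) (divgr A B y) *
                        bB (remgr A B x) (remgr A B y))%R.
Proof.
case/dprodP=> _ defG cAB tiAB [bAC bA1 bAM bAn] [bBC bB1 bBM bBn].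
have nAG : A <| G by rewrite -defG -cent_joinEr // normalYl cents_norm.
have co : B \in [complements to A in G] by apply/complP.
have dA x : x \in G -> divgr A B x \in A by rewrite -defG; apply: mem_divgr.
have dB x : x \in G -> remgr A B x \in B by rewrite -defG; apply: mem_remgr.
have sAG : {subset A <= G} by apply/subsetP; rewrite -defG mulG_subl.
have sBG : {subset B <= G} by apply/subsetP; rewrite -defG mulG_subr.
split=> [x y Gx Gy|y Gy|x x' y Gx Gx' Gy|x Gx xP].
- by rewrite bAC ?dA // bBC ?dB.
- by rewrite divgr_id // remgr1 // bA1 ?dA ?bB1 ?dB ?mulr1.
- rewrite (divgrM co) // (remgrM co) //.
  rewrite (bAM _ _ _ (dA _ Gx) (dA _ Gx') (dA _ Gy)).
  rewrite (bBM _ _ _ (dB _ Gx) (dB _ Gx') (dB _ Gy)).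
  by rewrite mulrACA.
- rewrite (divgr_eq A B x); suff: divgr A B x = 1 /\ remgr A B x = 1.
    by case=> -> ->; rewrite mulg1.
  split; [apply: (bAn _ (dA _ Gx)) | apply: (bBn _ (dB _ Gx))].
  + move=> y Ay; have := xP y (sAG y Ay).
    by rewrite (divgr_id _ Ay) (remgr1 _ Ay) bBC ?dB // bB1 ?dB // mulr1.
  + move=> y By; have := xP y (sBG y By).
    rewrite /(divgr A B y) (remgr_id tiAB By) mulgV.
    by rewrite bAC ?dA // bA1 ?dA // mul1r.
Qed.

(** Orthogonal sum over a decomposition into cyclic factors. *)
Lemma pairing_exists (gT : finGroupType) (G : {group gT}) :
  abelian G -> {b | pairing G b}.
Proof.
case/abelian_structure=> s defG _; elim: s G defG => [|x s IHs] G.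
  rewrite big_nil => <-; exists (fun _ _ => 1%R); split=> //.
    by move=> *; rewrite mulr1.
  by move=> x /set1P.
rewrite big_cons.
set D := \big[dprod/1]_(y <- s) <[y]> in IHs * => defG; pose B := <<D>>%G.
have defB : D = B.
  by case/dprodP: defG => [[_ B' _ defB'] _ _ _]; rewrite /B /= defB' genGid.
have [bB bBP] := IHs B defB; have [bA bAP] := pairing_cycle x.
by rewrite defB in defG; exact: exist _ _ (pairing_dprod defG bAP bBP).
Qed.

(** * Orthogonal complements and biduality *)

Definition perp (gT : finGroupType) (b : gT -> gT -> algC) (A : {set gT}) :=
  [set x | [forall y in A, b x y == 1%R]].

Section Perp.

Variables (gT : finGroupType) (b : gT -> gT -> algC).
Hypothesis bP : pairing [set: gT] b.

Lemma perpP (A : {set gT}) x :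
  reflect {in A, forall y, b x y = 1%R} (x \in perp b A).
Proof. by rewrite inE; apply: (iffP forall_inP) => h y /h/eqP. Qed.

Lemma pairM x x' y : b (x * x') y = (b x y * b x' y)%R.
Proof. exact: (pairingM bP) (in_setT _) (in_setT _) (in_setT _). Qed.

Lemma pairC x y : b x y = b y x.
Proof. exact: (pairingC bP) (in_setT _) (in_setT _). Qed.

Lemma pair1x y : b 1 y = 1%R.
Proof. exact: (pairing1 bP) (in_setT _). Qed.

Lemma pairx1 y : b y 1 = 1%R. Proof. by rewrite pairC pair1x. Qed.

Lemma pair_neq0 x y : (b x y != 0)%R.
Proof.
apply: contra_neqN (oner_neq0 algC) => /eqP b0.
by rewrite -(pair1x y) -(mulgV x) pairM b0 mul0r.
Qed.

Lemma pairV x y : b x^-1 y = ((b x y)^-1)%R.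
Proof.
apply: (mulfI (pair_neq0 x y)).
by rewrite -pairM mulgV pair1x divff ?pair_neq0.
Qed.

Lemma pair_nondeg x : (forall y, b x y = 1%R) -> x = 1.
Proof. by move=> bx1; apply: (pairing_nondeg bP) => // y _. Qed.

Lemma group_set_perp A : group_set (perp b A).
Proof.
apply/group_setP; split=> [|x y /perpP xA /perpP yA]; apply/perpP=> z Az.
  exact: pair1x.
by rewrite pairM xA ?yA ?mulr1.
Qed.

Lemma perp_gen A : perp b <<A>> = perp b A.
Proof.
apply/setP=> x; apply/perpP/perpP=> xA y Ay; first by rewrite xA ?mem_gen.
suff: <<A>> \subset group (group_set_perp [set x]).
  by move/subsetP/(_ y Ay)/perpP; rewrite pairC; apply; rewrite set11.
rewrite gen_subG; apply/subsetP=> z Az.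
by apply/perpP=> _ /set1P->; rewrite pairC xA.
Qed.

(** Orthogonality of characters: if [b z y] differs from 1 for some [z] in [H], translating the sum
    by [z] multiplies it by [b z y], so it vanishes. *)
Lemma sum_pair (H : {group gT}) y :
  (\sum_(x in H) b x y = (if y \in perp b H then #|H| else 0)%:R)%R.
Proof.
case: perpP => [yH|/perpP yH].
  rewrite -sumr_const; apply: eq_bigr => x Hx.
  by rewrite pairC yH.
rewrite inE negb_forall_in in yH; case/exists_inP: yH => z Hz.
rewrite pairC -subr_eq0 => nbz1; apply: (mulfI nbz1).
rewrite mulr0 mulrBl mul1r; apply/eqP; rewrite subr_eq0 mulr_sumr.
rewrite [X in _ == X](reindex_inj (mulgI z)) /=; apply/eqP.
by apply: eq_big => [x|x _]; rewrite ?groupMl // pairM.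
Qed.

(* Double counting of the sum of b x y over x in H and all y. *)
Lemma card_perp (H : {group gT}) : (#|H| * #|perp b H| = #|gT|)%N.
Proof.
have E: (\sum_(x in H) \sum_y b x y = \sum_y \sum_(x in H) b x y)%R.
  exact: exchange_big.
apply/eqP; rewrite -(eqr_nat algC) eq_sym natrM; apply/eqP.
transitivity (\sum_(x in H) \sum_y b x y)%R; last first.
  rewrite E (eq_bigr _ (fun y _ => sum_pair H y)).
  rewrite (bigID (mem (perp b H))) /= [X in (_ + X)%R]big1 => [|y /negPf->//].
  rewrite addr0 (eq_bigr (fun _ => (#|H|)%:R)%R) => [|y ->//].
  by rewrite sumr_const mulr_natr.
rewrite (bigD1 1) //= [X in (_ + X)%R]big1 => [|x /andP[_ x1]].
  by rewrite addr0 (eq_bigr (fun _ => 1%R)) ?sumr_const // => y _;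
    apply: pair1x.
(* By nondegeneracy [x] is not orthogonal to the whole group, so the sum over all [y] vanishes by
   [sum_pair]. *)
have xT : x \notin perp b [set: gT].
  apply: contraNN x1 => /perpP x1; apply/eqP/pair_nondeg => y.
  exact/x1/in_setT.
rewrite -[RHS]/(0%:R)%R; have <- : (if x \in
  perp b [set: gT] then #|[set: gT]| else 0) = 0.
  by rewrite (negPf xT).
rewrite -(sum_pair [set: gT]%G); apply: eq_big => [y|y _]; first by rewrite inE.
exact: pairC.
Qed.

(** [H] lies in its double complement, and [card_perp] for [H] and for its complement shows that the
    orders agree. *)
Lemma perpK (H : {group gT}) : perp b (perp b H) = H.
Proof.
apply/esym/eqP; rewrite eqEcard; apply/andP; split.
  by apply/subsetP=> x Hx; apply/perpP=> y /perpP yH; rewrite pairC yH.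
have := card_perp H; rewrite -(card_perp (group (group_set_perp H))) /=.
by rewrite mulnC => /eqP; rewrite eqn_pmul2l ?(cardG_gt0 (group (group_set_perp
  H))) // => /eqP->.
Qed.

(** Contrapositive of biduality; existence statements are proved by duality in this form below. *)
Lemma perp_separates (H : {group gT}) y : y \notin H ->
  exists2 x, x \in perp b H & b x y != 1%R.
Proof.
move=> Hy; apply/exists_inP; rewrite -negb_forall_in; apply: contraNN Hy.
move/forall_inP=> yH; rewrite -[H : {set _}]perpK; apply/perpP=> x /yH/eqP.
by rewrite pairC.
Qed.

End Perp.

(** * Pairings on products *)

Lemma pairing_inv (gT : finGroupType) b :
  pairing [set: gT] b -> pairing [set: gT] (fun x y => (b x y)^-1)%R.
Proof.
case=> bC b1 bM bn; split=> [x y Ax Ay|y Ay|x x' y Ax Ax' Ay|x Ax xP].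
- by rewrite bC.
- by rewrite b1 ?invr1.
- by rewrite bM // invfM.
- by apply: bn => // y Ay; apply: invr_inj; rewrite invr1 xP.
Qed.

Lemma pairing_prod (gT hT : finGroupType) b c :
    pairing [set: gT] b -> pairing [set: hT] c ->
  pairing [set: gT * hT] (fun x y => b x.1 y.1 * c x.2 y.2)%R.
Proof.
move=> bP cP; split=> [x y _ _|y _|x x' y _ _ _|[x1 x2] _ xP].
- by rewrite (pairC bP) (pairC cP).
- by rewrite (pair1x bP) (pair1x cP) mulr1.
- by rewrite (pairM bP) (pairM cP) mulrACA.
- congr (_, _).
  + apply: (pair_nondeg bP) => y; have := xP (y, 1) (in_setT _).
    by rewrite /= (pairx1 cP) mulr1.
  + apply: (pair_nondeg cP) => y; have := xP (1, y) (in_setT _).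
    by rewrite /= (pairx1 bP) mul1r.
Qed.

Lemma pairing_dffun (I : finType) (G : I -> finGroupType) 
    (b : forall i, G i -> G i -> algC) :
    (forall i, pairing [set: G i] (b i)) ->
  pairing [set: {dffun forall i, G i}] (fun u v => \prod_i b i (u i) (v i))%R.
Proof.
move=> bP; split=> [u v _ _|v _|u u' v _ _ _|u _ uP].
- by apply: eq_bigr => i _; rewrite (pairC (bP i)).
- by apply: big1 => i _; rewrite ffunE (pair1x (bP i)).
- by rewrite -big_split; apply: eq_bigr => i _; rewrite ffunE (pairM (bP i)).
- apply/ffunP=> i; rewrite ffunE; apply: (pair_nondeg (bP i)) => y.
  (* Testing against an element supported at [i] isolates the factor at [i]. *)
  rewrite -[RHS](uP (dfung1 y) (in_setT _)) (bigD1 i) //= dfung1_id.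
  rewrite big1 ?mulr1 // => j ji.
  by rewrite dfung1_dflt 1?eq_sym // (pairx1 (bP j)).
Qed.

Lemma pair_dfung1 (I : finType) (G : I -> finGroupType)
    (b : forall i, G i -> G i -> algC) i (x : G i) (u : {dffun forall i, G i}) :
    (forall i, pairing [set: G i] (b i)) ->
  (\prod_j b j (dfung1 x j) (u j))%R = b i x (u i).
Proof.
move=> bP; rewrite (bigD1 i) //= dfung1_id big1 ?mulr1 // => j ji.
by rewrite dfung1_dflt 1?eq_sym // (pair1x (bP j)).
Qed.

(** * Linked subgroups and amalgam configurations *)

Section Systems.

Variables (I : finType) (G : I -> finGroupType).

(* L i j is the stabilizer in G i * G j of any basis relation between the
   fibers i and j. *)
Record linking (L : forall i j, {set G i * G j}) : Prop := Linking {
  link_group : forall i j, group_set (L i j);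
  link_diag : forall i (g h : G i), ((g, h) \in L i i) = (g == h);
  link_sym : forall i j (g : G i) (h : G j),
    (g, h) \in L i j -> (h, g) \in L j i;
  link_comp : forall i j k (g : G i) (h : G j), (g, h) \in L i j ->
    exists2 c : G k, (g, c) \in L i k & (c, h) \in L k j
}.

(** [graph_comp] reverses the inclusion of [link_comp]; with [graph_diag] and [graph_sym] it makes
    each [M i j] the graph of an isomorphism between subgroups. *)
Record graph_system (M : forall i j, {set G i * G j}) : Prop := GraphSystem {
  graph_group : forall i j, group_set (M i j);
  graph_diag : forall i (x y : G i), ((x, y) \in M i i) = (x == y);
  graph_sym : forall i j (x : G i) (y : G j),
    (x, y) \in M i j -> (y, x) \in M j i;
  graph_comp : forall i j k (x : G i) (z : G k) (y : G j),
    (x, z) \in M i k -> (z, y) \in M k j -> (x, y) \in M i j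
}.

Definition am_graph (A : amalgam_configuration G) i j : {set G i * G j} :=
  [set p | (p.1 \in am_U A i j) && (am_f A i j p.1 == p.2)].

Lemma am_graphP (A : amalgam_configuration G) i j x y :
  reflect (x \in am_U A i j /\ am_f A i j x = y) ((x, y) \in am_graph A i j).
Proof. by rewrite inE; apply: (iffP andP) => -[-> /eqP]. Qed.

Lemma am_eq_graph (A B : amalgam_configuration G) :
  am_eq A B <-> forall i j, am_graph A i j = am_graph B i j.
Proof.
split=> [AB i j|AB i j].
  have [eU ef] := AB i j; apply/setP=> -[x y].
  apply/am_graphP/am_graphP=> -[Ux <-].
    by split; [rewrite -eU | rewrite ef].
  by rewrite -eU in Ux; split=> //; rewrite ef.
have eU : am_U A i j = am_U B i j.
  apply/group_inj/setP=> x; apply/idP/idP=> Ux.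
    have: (x, am_f A i j x) \in am_graph A i j by apply/am_graphP.
    by rewrite AB => /am_graphP[].
  have: (x, am_f B i j x) \in am_graph B i j by apply/am_graphP.
  by rewrite -AB => /am_graphP[].
split=> // x Ux; have: (x, am_f A i j x) \in am_graph A i j by apply/am_graphP.
by rewrite AB => /am_graphP[].
Qed.

Lemma am_graph_system (A : amalgam_configuration G) : graph_system (am_graph A).
Proof.
have fim i j x : x \in am_U A i j -> am_f A i j x \in am_U A j i.
  by case/isomP: (am_isom A i j) => _ <- Ux; apply: mem_morphim.
split=> [i j|i x y|i j x y|i j k x z y].
- apply/group_setP; split=> [|[x y] [x' y']].
    by apply/am_graphP; rewrite group1 morph1.
  case/am_graphP=> Ux <- /am_graphP[Ux' <-]; apply/am_graphP.
  by rewrite groupM ?morphM.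
- by rewrite inE /= am_fii am_Uii inE.
- by case/am_graphP=> Ux <-; apply/am_graphP; rewrite fim ?am_fK.
- case/am_graphP=> Ux <- /am_graphP[Uz <-]; apply/am_graphP.
  have Uzi := fim _ _ _ Ux.
  (* By [am_cap], the image of [x] under f_ik is also the image of an element of U_ij and U_ik;
     injectivity of f_ik identifies that element with [x]. *)
  have Uij : x \in am_U A i j.
    have: am_f A i k x \in am_f A i k @* (am_U A i j :&: am_U A i k).
      by rewrite am_cap inE Uzi.
    case/morphimP=> x' Ux' /setIP[Uijx' _] eqf.
    case/isomP: (am_isom A i k) => /injmP inj _.
    by rewrite (inj _ _ Ux Ux' eqf).
  split=> //.
  (* [y'] lies in U_ji, so it is f_ij applied to f_ji of [y'], and the cocycle condition turns the
     latter into [x]. *)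
  set y' := am_f A k j _; have: y' \in am_f A k j @* (am_U A k i :&: am_U A k
    j).
    by apply: mem_morphim; rewrite // inE Uzi Uz.
  rewrite am_cap => /setIP[_ Uy].
  rewrite -(@am_fK _ _ A j i y' Uy); congr (am_f A i j _).
  by rewrite /y' am_cocycle // inE Uij.
Qed.

(** U_ij is the projection of [M i j] to the first factor. The result is a sigma type because the
    correspondence is built from its witness. *)
Lemma amalgam_of_graph M :
  graph_system M -> {A | forall i j, am_graph A i j = M i j}.
Proof.
case=> Mg Md Ms Mc.
pose U i j := [set x : G i | [exists y : G j, (x, y) \in M i j]].
have UP i j x : reflect (exists y, (x, y) \in M i j) (x \in U i j).
  by rewrite inE; apply: existsP.
have UG i j : group_set (U i j).
  apply/group_setP; split=> [|x x' /UP[y Mxy] /UP[y' Mxy']]; apply/UP.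
    by exists 1; apply: (group1 (Group (Mg i j))).
  by exists (y * y'); apply: (groupM (G := Group (Mg i j)) Mxy Mxy').
(* The default 1 is taken only outside [U i j]. *)
pose f i j (x : G i) : G j := odflt 1 [pick y | (x, y) \in M i j].
have fP i j x : x \in U i j -> (x, f i j x) \in M i j.
  by case/UP=> y Mxy; rewrite /f; case: pickP => [//|/(_ y)]; rewrite Mxy.
(* Two partners of [x] form, by composition through [x], a pair of [M j j], which is the
   diagonal. *)
have uniq_f i j x y : (x, y) \in M i j -> f i j x = y.
  move=> Mxy; have/fP/Ms Mf : x \in U i j by apply/UP; exists y.
  by apply/eqP; rewrite -Md; apply: Mc Mf Mxy.
have domf i j x y : (x, y) \in M i j -> x \in U i j by move=> h; apply/UP;
  exists y.
have fM i j : {in U i j &, {morph f i j : x y / x * y}}.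
  move=> x y /fP Mx /fP My; apply: uniq_f.
  exact: (groupM (G := Group (Mg i j)) Mx My).
pose UU i j := Group (UG i j); pose ff i j := @Morphism _ _ (UU i j) _ (fM i j).
have isomf i j : isom (UU i j) (UU j i) (ff i j).
  apply/isomP; split.
    apply/injmP=> x x' /fP Mx /fP Mx' /= eqf; rewrite eqf in Mx.
    by apply/eqP; rewrite -Md; apply: Mc Mx (Ms _ _ _ _ Mx').
  apply/setP=> y; apply/morphimP/idP=> [[x _ /fP/Ms/domf Uy -> //]|/fP/Ms Mxy].
  by exists (f j i y); [apply: domf Mxy | apply: domf Mxy | rewrite /= (uniq_f
    _ _ _ _ Mxy)].
have fK i j : {in UU i j, forall x, ff j i (ff i j x) = x}.
  by move=> x /fP/Ms/uniq_f.
have Uii i : UU i i = [set: G i] :> {set G i}.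
  by apply/setP=> x; rewrite !inE; apply/existsP; exists x; rewrite Md.
have fii i : {in UU i i, forall x, ff i i x = x}.
  by move=> x _; apply: uniq_f; rewrite Md.
have cap i j k : ff i k @* (UU i j :&: UU i k) = UU k i :&: UU k j.
  apply/setP=> z; apply/morphimP/setIP=> [[x _ /setIP[/fP Mij /fP Mik] ->]|].
    split; [exact: domf (Ms _ _ _ _ Mik) | exact: domf (Mc _ _ _ _ _ _ (Ms _ _
      _ _ Mik) Mij)].
  case=> /fP/Ms Mik /fP Mkj; exists (f k i z).
  - exact: domf Mik.
  - by apply/setIP; split; [apply: domf (Mc _ _ _ _ _ _ Mik Mkj) | apply: domf
    Mik].
  - by rewrite /= (uniq_f _ _ _ _ Mik).
have cocycle i j k : {in UU i j :&: UU i k,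
    forall x, ff j i (ff k j (ff i k x)) = x}.
  move=> x /setIP[/fP Mij /fP Mik]; apply: (uniq_f).
  have Mkj := Mc _ _ _ _ _ _ (Ms _ _ _ _ Mik) Mij.
  by rewrite /= (uniq_f _ _ _ _ Mkj); apply: Ms.
exists (AmalgamConfiguration isomf Uii fii fK cap cocycle) => i j.
apply/setP=> -[x y]; apply/am_graphP/idP => /= [[/fP Mx <-]//|Mxy].
by rewrite (uniq_f _ _ _ _ Mxy); split=> //; apply: domf Mxy.
Qed.

(** * Duality between linked subgroups and graphs *)

Variable b : forall i, G i -> G i -> algC.
Arguments b : clear implicits.
Hypothesis bP : forall i, pairing [set: G i] (b i).

(* The inverse makes (x, y) orthogonal to (g, h) when b x g = b y h, so that
   the orthogonal complement of the diagonal is the diagonal. *)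
Definition pair2 i j (p q : G i * G j) := (b i p.1 q.1 * (b j p.2 q.2)^-1)%R.

Definition perp2 (A : forall i j, {set G i * G j}) i j :=
  perp (@pair2 i j) (A i j).

Lemma pairing2 i j : pairing [set: G i * G j] (@pair2 i j).
Proof. exact: pairing_prod (bP i) (pairing_inv (bP j)). Qed.

Lemma pair2_eq1 i j (x g : G i) (y h : G j) :
  (pair2 (x, y) (g, h) == 1%R) = (b i x g == b j y h).
Proof.
rewrite /pair2 /= -(inj_eq (mulIf (pair_neq0 (bP j) y h))) mul1r.
by rewrite divfK ?(pair_neq0 (bP j)).
Qed.

Lemma perp2P (A : forall i j, {set G i * G j}) i j x y : reflect
  (forall g h, (g, h) \in A i j -> b i x g = b j y h) ((x, y) \in perp2 A i j).
Proof.
apply: (iffP (perpP _ _ _)) => [Axy g h /Axy/eqP|Axy [g h] /Axy eb].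
  by rewrite pair2_eq1 => /eqP.
by apply/eqP; rewrite pair2_eq1; apply/eqP.
Qed.

Lemma perp2K (A : forall i j, {set G i * G j}) i j :
  group_set (A i j) -> perp2 (perp2 A) i j = A i j.
Proof. by move=> gA; apply: (perpK (pairing2 i j) (Group gA)). Qed.

Lemma perp2_group (A : forall i j, {set G i * G j}) i j :
  group_set (perp2 A i j).
Proof. exact: group_set_perp (pairing2 i j) _. Qed.

(** If [x] and [y] pair equally with every [g], nondegeneracy makes their quotient trivial. *)
Lemma perp2_diag (A : forall i j, {set G i * G j}) i : (forall g h :
  G i, ((g, h) \in A i i) = (g == h)) ->
  forall x y : G i, ((x, y) \in perp2 A i i) = (x == y).
Proof.
move=> Ad x y; apply/perp2P/eqP=> [Axy|-> g h]; last by rewrite Ad => /eqP->.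
apply/eqP; rewrite eq_mulgV1; apply/eqP/(pair_nondeg (bP i)) => g.
rewrite (pairM (bP i)) (pairV (bP i)) (Axy g g) ?Ad //.
by rewrite divff ?(pair_neq0 (bP i)).
Qed.

Lemma perp2_sym (A : forall i j, {set G i * G j}) i j :
    (forall (g : G i) (h : G j), (g, h) \in A i j -> (h, g) \in A j i) ->
  forall x y, (y, x) \in perp2 A j i -> (x, y) \in perp2 A i j.
Proof. by move=> As x y /perp2P Ayx; apply/perp2P=> g h /As/Ayx. Qed.

(** Factoring [(g, h)] through [c] gives [b x g = b z c = b y h], so the inclusion satisfied by [L]
    is reversed in the complements. *)
Lemma perp_linking L : linking L -> graph_system (perp2 L).
Proof.
case=> _ Ld Ls Lc; split=> [i j|i|i j x y|i j k x z y].
- exact: perp2_group.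
- exact: perp2_diag.
- by apply: perp2_sym; apply: Ls.
- move=> /perp2P Lxz /perp2P Lzy; apply/perp2P=> g h /Lc-/(_ k)[c Lgc Lch].
  by rewrite (Lxz _ _ Lgc) (Lzy _ _ Lch).
Qed.

Hypothesis abelG : forall i, abelian [set: G i].

(** The harder direction: a middle element [c] has to be produced, and biduality yields it by
    contradiction. *)
Lemma perp_graph_system M : graph_system M -> linking (perp2 M).
Proof.
case=> Mg Md Ms Mc; split=> [i j|i|i j x y|i j k g h].
- exact: perp2_group.
- exact: perp2_diag.
- by apply: perp2_sym; apply: Ms.
have bkC : forall x y : G k, x * y = y * x.
  by move=> x y; apply: (centsP (abelG k)); rewrite inE.
(* V is (M i k x 1) (1 x M k j) in G i * G k * G j, and H is the projection of
   its orthogonal complement: (x, y) in H^perp forces (x, 1, y^-1) in V. *)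
pose V := [set t : G i * G k * G j |
  [exists z, ((t.1.1, z) \in M i k) && ((z^-1 * t.1.2, t.2) \in M k j)]].
have VG : group_set V.
  apply/group_setP; split=> [|[[x c] y] [[x' c'] y']].
    rewrite inE; apply/existsP; exists 1; rewrite /= mulg1 invg1.
    by rewrite (group1 (Group (Mg i k))) (group1 (Group (Mg k j))).
  rewrite !inE => /existsP[z /andP[/= Mxz Mcy]] /existsP[z' /andP[/= Mxz'
    Mcy']].
  apply/existsP; exists (z * z'); rewrite /=.
  rewrite (groupM (G := Group (Mg i k)) Mxz Mxz') /=.
  have -> : (z * z')^-1 * (c * c') = (z^-1 * c) * (z'^-1 * c').
    by rewrite invMg (bkC z'^-1) -!mulgA !(mulgA _ _ c') (bkC c).
  exact: (groupM (G := Group (Mg k j)) Mcy Mcy').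
pose H := [set p : G i * G j |
  [exists c, ((p.1, c) \in perp2 M i k) && ((c, p.2) \in perp2 M k j)]].
have HG : group_set H.
  apply/group_setP; split=> [|[x y] [x' y']].
    rewrite inE; apply/existsP; exists 1.
    by rewrite (group1 (Group (perp2_group M i k))) (group1 (Group (perp2_group
      M k j))).
  rewrite !inE => /existsP[z /andP[Mxz Mcy]] /existsP[z' /andP[Mxz' Mcy']].
  apply/existsP; exists (z * z').
  rewrite (groupM (G := Group (perp2_group M i k)) Mxz Mxz') /=.
  by rewrite (groupM (G := Group (perp2_group M k j)) Mcy Mcy').
move=> /perp2P Mgh; have [|nH] := boolP ((g, h) \in H).
  by rewrite inE => /existsP[c /andP[gc ch]]; exists c.
(* If no [c] exists, some [(x, y)] is orthogonal to every factorable pair but not to [(g, h)]. *)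
have [[x y] /perpP xyH] := perp_separates (pairing2 i j) (H := Group HG) nH.
rewrite pair2_eq1 => /negP[]; apply/eqP.
(* Membership in [V] gives [z] with [(x, z)] in [M i k] and [(z, y)] in [M k j], hence [(x, y)] in
   [M i j], to which [(g, h)] is orthogonal. *)
suff: ((x, 1), y^-1) \in V.
  rewrite inE => /existsP[z /andP[/= Mxz]]; rewrite mulg1 => Mzy.
  rewrite -!(pairC (bP _) _ x) -!(pairC (bP _) _ y).
  apply/Mgh/(Mc _ _ _ _ _ _ Mxz).
  have: (z^-1^-1, y^-1^-1) \in M k j := groupVr (G := Group (Mg k j)) Mzy.
  by rewrite !invgK.
have p3 := pairing_prod (pairing2 i k) (bP j).
(* Otherwise some [(g', c, h')] orthogonal to [V] detects the triple; restricted to each factor of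
   [V], it shows that [(g', h')] factors through [c], so it is in [H] and orthogonal to [(x, y)]. *)
apply: contraT => /(perp_separates p3 (H := Group VG))[[[g' c] h'] /perpP cV].
rewrite /= /pair2 /=.
rewrite (pairx1 (bP k)) invr1 mulr1 !(pairC (bP j) h') (pairV (bP j)).
suff: (g', h') \in H.
  move/xyH/eqP; rewrite pair2_eq1 !(pairC (bP _) g') => /eqP->.
  by rewrite divff ?pair_neq0 ?eqxx.
rewrite inE; apply/existsP; exists c; apply/andP; split; apply/perp2P.
  move=> x' z Mxz; have := cV (x', z, 1);
    rewrite /= /pair2 /= (pairx1 (bP j)) mulr1.
  move=> /(_ _)/eqP; rewrite -/(pair2 (g', c) (x', z)) pair2_eq1 => /(_ _)/eqP;
    apply.
  rewrite inE; apply/existsP; exists z; rewrite /= Mxz mulVg.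
  exact: (group1 (Group (Mg k j))).
move=> z y' Mzy; have := cV (1, z, y'); rewrite /= /pair2 /= (pairx1 (bP i))
  mul1r => /(_ _).
rewrite inE /= => E; apply/esym/(mulfI (invr_neq0 (pair_neq0 (bP k) c z))).
rewrite mulVf ?pair_neq0 // E //; apply/existsP; exists 1.
by rewrite invg1 mul1g Mzy (group1 (Group (Mg i k))).
Qed.

End Systems.

(** * Basis relations as cosets of linked subgroups *)

Section SameRelation.

Variables (T : finType) (S : {set {set T * T}}).
Hypothesis cohS : coherent [set: T] S.

Definition same_rel (p q : T * T) := q \in pblock S p.

Lemma coherent_cover p : p \in cover S.
Proof.
by have /cover_partition-> := coherent_partition cohS; rewrite !inE.
Qed.

Lemma same_rel_block s p q : s \in S -> p \in s -> (q \in s) = same_rel p q.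
Proof.
case/and3P: (coherent_partition cohS) => _ tiS _ Ss sp.
by rewrite /same_rel (def_pblock tiS Ss sp).
Qed.

Lemma block_of p : exists2 s, s \in S & p \in s.
Proof.
by exists (pblock S p); [apply: pblock_mem | rewrite mem_pblock];
   apply: coherent_cover.
Qed.

Lemma same_rel_refl p : same_rel p p.
Proof. by have [s Ss sp] := block_of p; rewrite -(same_rel_block _ Ss). Qed.

Lemma same_rel_eq p q : same_rel p q -> same_rel p =1 same_rel q.
Proof.
have [s Ss sp] := block_of p; rewrite -(same_rel_block _ Ss sp) => sq r.
by rewrite -(same_rel_block r Ss sp) -(same_rel_block r Ss sq).
Qed.

Lemma same_rel_sym p q : same_rel p q = same_rel q p.
Proof.
by apply/idP/idP=> /same_rel_eq/[dup] e; rewrite -?e ?same_rel_refl.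
Qed.

Lemma same_rel_trans q p r : same_rel p q -> same_rel q r -> same_rel p r.
Proof. by move/same_rel_eq->. Qed.

Lemma mem_conv_rel (s : {set T * T}) x y :
  ((x, y) \in conv_rel s) = ((y, x) \in s).
Proof.
apply/imsetP/idP=> [[[a b] sab [-> ->]] //|syx].
by exists (y, x).
Qed.

Lemma mem_diag_rel (D : {set T}) x y : ((x,
  y) \in diag_rel D) = (x \in D) && (x == y).
Proof.
apply/imsetP/andP=> [[z Dz [-> ->]] //|[Dx /eqP<-]].
by exists x.
Qed.

Lemma same_rel_swap x y x' y' : same_rel (x, y) (x', y') -> same_rel (y,
  x) (y', x').
Proof.
have [s Ss sp] := block_of (x, y); rewrite -(same_rel_block _ Ss sp) => sq.
have := coherent_conv cohS Ss => Ss'.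
by rewrite -(same_rel_block (s := conv_rel s)) // mem_conv_rel.
Qed.

Lemma same_rel_diag x y z : same_rel (x, x) (y, z) -> y = z.
Proof.
have [D [sDS defD]] := coherent_diag cohS.
have: (x, x) \in cover D by rewrite -defD mem_diag_rel inE eqxx.
case/bigcupP=> s Ds sx; have Ss := subsetP sDS s Ds.
rewrite -(same_rel_block _ Ss sx) => sy.
have: (y, z) \in cover D by apply/bigcupP; exists s.
by rewrite -defD mem_diag_rel => /andP[_ /eqP].
Qed.

(** Coherence as path lifting: the number of middle points is positive at [(x, y)], hence at
    [(x', y')]. *)
Lemma same_rel_lift x y x' y' z : same_rel (x, y) (x', y') ->
  exists2 z', same_rel (x, z) (x', z') & same_rel (z, y) (z', y').
Proof.
have [t St tp] := block_of (x, y); rewrite -(same_rel_block _ St tp) => tq.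
have [r Sr rp] := block_of (x, z); have [s Ss sp] := block_of (z, y).
have mem_int u v w : (w \in nbrs r u :&: nbrs (conv_rel s) v) =
    ((u, w) \in r) && ((w, v) \in s).
  by rewrite !inE mem_conv_rel.
have := coherent_intersection cohS Sr Ss St tp tq => /= eqn.
have: 0 < #|nbrs r x' :&: nbrs (conv_rel s) y'|.
  by rewrite -eqn (cardD1 z) mem_int rp sp.
case/card_gt0P=> z'; rewrite mem_int => /andP[rz' sz'].
by exists z'; rewrite -?(same_rel_block _ Sr rp) -?(same_rel_block _ Ss sp).
Qed.

Lemma same_rel_fiber D x y x' y' : D \in fibers S -> same_rel (x, y) (x', y') ->
  (x' \in D) = (x \in D).
Proof.
rewrite inE => SD; wlog suff: x y x' y' / same_rel (x, y) (x',
  y') -> x \in D -> x' \in D.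
  move=> W xy; apply/idP/idP; last exact: W xy.
  by apply: (W x' y' x y); rewrite same_rel_sym.
(* Lifting [x] itself as the middle point puts [(x', z)] in the basis relation of [(x, x)]. *)
move=> xy Dx; have [z xz _] := same_rel_lift x xy.
have: (x', z) \in diag_rel D by rewrite (same_rel_block (p :=
  (x, x))) ?mem_diag_rel ?Dx /=.
by rewrite mem_diag_rel => /andP[].
Qed.

Lemma same_rel_fiber2 D x y x' y' : D \in fibers S -> same_rel (x, y) (x',
  y') ->
  (y' \in D) = (y \in D).
Proof. by move=> SD /same_rel_swap/(same_rel_fiber SD). Qed.

End SameRelation.

(** * Fibers, labels and linked subgroups of a configuration *)

Section Labels.

Variables (I : finType) (G : I -> finGroupType) (X : qcc_of_type G).

Local Notation S := (qcc_basis X).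
Local Notation F := (qcc_fiber X).
Local Notation lab := (@qcc_label I G X _).
Local Notation "p ~~ q" := (same_rel S p q) (at level 70).

Lemma qcc_coherent : coherent [set: qcc_point X] S.
Proof. by case: (qcc_quasiregular X). Qed.
Local Notation coh := qcc_coherent.

Lemma qcc_fiberP i : F i \in fibers S.
Proof. by rewrite -qcc_fiber_im imset_f. Qed.

(** The basis relation through [(x, x)] lies in the diagonal, so it is the diagonal of a fiber. *)
Lemma qcc_fiber_ex x : exists i, x \in F i.
Proof.
have [D [sDS defD]] := coherent_diag coh.
have: (x, x) \in cover D by rewrite -defD mem_diag_rel inE eqxx.
case/bigcupP=> s Ds sx; have Ss := subsetP sDS s Ds.
have: [set y | (y, y) \in s] \in fibers S.
  rewrite inE; suff <- : s = diag_rel [set y | (y, y) \in s] by [].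
  apply/setP=> -[y z]; rewrite mem_diag_rel inE;
    apply/idP/andP=> [|[sy /eqP<-//]].
  move=> syz; have := same_rel_diag coh (x := x) (y := y) (z := z).
  by rewrite -(same_rel_block coh _ Ss sx) => /(_ syz) yz; rewrite -yz in syz *.
rewrite -qcc_fiber_im => /imsetP[i _ Fi].
by exists i; rewrite -Fi inE.
Qed.

Lemma qcc_fiber_uniq i j x : x \in F i -> x \in F j -> i = j.
Proof.
move=> Fix Fjx; apply: (@qcc_fiber_inj _ _ X); apply/setP=> y.
have Si := qcc_fiberP i; have Sj := qcc_fiberP j; rewrite !inE in Si Sj.
have := same_rel_block coh (y, y) Si (p := (x, x)).
have := same_rel_block coh (y, y) Sj (p := (x, x)).
by rewrite !mem_diag_rel !eqxx !andbT => -> // ->.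
Qed.

Lemma qcc_fiber_neq0 i : exists x, x \in F i.
Proof.
have := qcc_fiberP i; rewrite inE => Si.
case/and3P: (coherent_partition coh) => _ _ S0.
apply/set0Pn; apply: contraNneq S0 => F0.
by move: Si; rewrite F0 /diag_rel imset0.
Qed.

Lemma qcc_labelP i (g : G i) : lab g \in hom_component S (F i).
Proof. by rewrite -qcc_label_im imset_f. Qed.

Lemma qcc_label_basis i (g : G i) : lab g \in S.
Proof. by have := qcc_labelP g; rewrite inE => /andP[]. Qed.

Lemma qcc_label_dom i (g : G i) x y : (x, y) \in lab g -> x \in F i.
Proof.
have := qcc_labelP g; rewrite inE => /andP[_ /subsetP sF] /sF.
by rewrite inE => /andP[].
Qed.

Lemma qcc_label_cod i (g : G i) x y : (x, y) \in lab g -> y \in F i.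
Proof.
have := qcc_labelP g; rewrite inE => /andP[_ /subsetP sF] /sF.
by rewrite inE => /andP[].
Qed.

Lemma qcc_label_ex i x y : x \in F i -> y \in F i -> exists g :
  G i, (x, y) \in lab g.
Proof.
move=> Fx Fy; have [s Ss sxy] := block_of coh (x, y).
have: s \in hom_component S (F i).
  rewrite inE Ss; apply/subsetP=> -[x' y'];
    rewrite (same_rel_block coh _ Ss sxy) => xy.
  by rewrite inE /= (same_rel_fiber coh (qcc_fiberP i) xy) Fx
             (same_rel_fiber2 coh (qcc_fiberP i) xy) Fy.
by rewrite -qcc_label_im => /imsetP[g _ defs]; exists g; rewrite -defs.
Qed.

Lemma qcc_label_uniq i (g h : G i) x y :
  (x, y) \in lab g -> (x, y) \in lab h -> g = h.
Proof.
move=> gx hx; apply: (@qcc_label_inj _ _ X); apply/setP=> p.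
by rewrite !(same_rel_block coh _ (qcc_label_basis _) gx)
           (same_rel_block coh _ (qcc_label_basis _) hx).
Qed.

Lemma qcc_label_thin i (g : G i) : thin (lab g).
Proof.
case: (qcc_quasiregular X) => _ /(_ _ (qcc_fiberP i))[_ _]; apply.
exact: qcc_labelP.
Qed.

Lemma qcc_label_fun i (g : G i) x y y' :
  (x, y) \in lab g -> (x, y') \in lab g -> y = y'.
Proof.
have [/card_le1P thg _] := qcc_label_thin g x => gy gy'.
have gy1 : y \in nbrs (lab g) x by rewrite inE.
by have := thg y gy1 y'; rewrite !inE gy' => /esym/eqP.
Qed.

(** Some pair [(a, b)] has label [g], and [(a, a)] and [(x, x)] lie in one basis relation, so the
    path through [b] lifts to [x]. *)
Lemma qcc_label_tot i (g : G i) x : x \in F i -> exists y, (x, y) \in lab g.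
Proof.
move=> Fx; case/and3P: (coherent_partition coh) => _ _ S0.
have /set0Pn[[a b] gab] : lab g != set0.
  by apply: contraNneq S0 => <-; apply: qcc_label_basis.
have SF := qcc_fiberP i; rewrite inE in SF.
have ax: (a, a) ~~ (x, x).
  by rewrite -(same_rel_block coh _ SF) mem_diag_rel eqxx ?Fx ?(qcc_label_dom
    gab).
have [y aby _] := same_rel_lift coh b ax.
by exists y; rewrite (same_rel_block coh _ (qcc_label_basis g) gab).
Qed.

Lemma qcc_label_mul i (g h : G i) x y z :
  (x, y) \in lab g -> (y, z) \in lab h -> (x, z) \in lab (g * h).
Proof.
move=> gxy hyz; rewrite qcc_labelM inE; apply/existsP; exists y.
by rewrite gxy.
Qed.

Lemma qcc_label1 i x : x \in F i -> (x, x) \in lab (1 : G i).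
Proof.
move=> Fx; have [g gx] := qcc_label_ex Fx Fx.
(* The label of [(x, x)] is idempotent, hence the identity. *)
have/(mulgI g g 1) <- // : g * g = g * 1.
by rewrite mulg1; apply: qcc_label_uniq (qcc_label_mul gx gx) gx.
Qed.

(** The middle point [z] lifts to a point at label [g] from [x'], which thinness forces to be
    [z']. *)
Lemma same_rel_transl i (g : G i) x y x' y' z z' :
    (x, z) \in lab g -> (x', z') \in lab g ->
  (x, y) ~~ (x', y') -> (z, y) ~~ (z', y').
Proof.
move=> gz gz' /(same_rel_lift coh z)[w xw].
by rewrite -(same_rel_block coh _ (qcc_label_basis g) gz) in xw;
  rewrite (qcc_label_fun gz' xw).
Qed.

Lemma same_rel_transl2 i (g : G i) x y x' y' z z' :
    (y, z) \in lab g -> (y', z') \in lab g ->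
  (x, y) ~~ (x', y') -> (x, z) ~~ (x', z').
Proof.
move=> gz gz' /(same_rel_swap coh)/(same_rel_transl gz gz').
by move/(same_rel_swap coh).
Qed.

(** Right translation by such a pair stabilizes every basis relation between the two fibers; for
    abelian groups one instance of the condition implies all of them, by [qcc_link_intro]. *)
Definition qcc_link i j : {set G i * G j} :=
  [set p | [forall x, forall x', forall y, forall y',
    ((x, x') \in lab p.1) ==> ((y, y') \in lab p.2) ==> ((x, y) ~~ (x', y'))]].

Lemma qcc_linkP i j (g : G i) (h : G j) : reflect
  (forall x x' y y', (x, x') \in lab g -> (y, y') \in lab h -> (x, y) ~~ (x',
    y'))
  ((g, h) \in qcc_link i j).
Proof.
rewrite inE; apply: (iffP forallP) => [l x x' y y' gx hy|l x].
  by have /forallP/(_ x')/forallP/(_ y)/forallP/(_ y')/implyP/(_ gx)/implyP/(_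
    hy) := l x.
apply/forallP=> x'; apply/forallP=> y; apply/forallP=> y'.
by apply/implyP=> gx; apply/implyP=> hy; apply: l.
Qed.

Hypothesis abelG : forall i, abelian [set: G i].

(* Commutativity of G i makes right translation by h an automorphism of the
   homogeneous component; qcc_link_intro fails without it. *)
Lemma qcc_label_comm i (g h : G i) x y z w :
  (x, y) \in lab g -> (x, z) \in lab h -> (y, w) \in lab h -> (z, w) \in lab g.
Proof.
move=> gxy hxz hyw; have [w' gzw'] := qcc_label_tot g (qcc_label_cod hxz).
have cgh: h * g = g * h by apply: (centsP (abelG i)); rewrite inE.
have := qcc_label_mul hxz gzw'; rewrite cgh => gh.
by rewrite (qcc_label_fun (qcc_label_mul gxy hyw) gh).
Qed.

(** Labels [a] and [c] carry [x] to [u] and [y] to [v]; by commutativity they also carry [x'] to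
    [u'] and [y'] to [v']. *)
Lemma qcc_link_intro i j (g : G i) (h : G j) x x' y y' :
    (x, x') \in lab g -> (y, y') \in lab h -> (x, y) ~~ (x', y') ->
  (g, h) \in qcc_link i j.
Proof.
move=> gx hy xy; apply/qcc_linkP=> u u' v v' gu hv.
have [a au] := qcc_label_ex (qcc_label_dom gx) (qcc_label_dom gu).
have [c cv] := qcc_label_ex (qcc_label_dom hy) (qcc_label_dom hv).
have au' := qcc_label_comm au gx gu; have cv' := qcc_label_comm cv hy hv.
exact: same_rel_transl au au' (same_rel_transl2 cv cv' xy).
Qed.

Lemma qcc_link_ex i j x x' y y' : x \in F i -> y \in F j -> (x, y) ~~ (x',
  y') ->
  exists g : G i, exists h : G j,
    [/\ (g, h) \in qcc_link i j, (x, x') \in lab g & (y, y') \in lab h].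
Proof.
move=> Fx Fy xy.
have [g gx] : exists g : G i, (x, x') \in lab g.
  by apply: qcc_label_ex; rewrite ?(same_rel_fiber coh (qcc_fiberP i) xy).
have [h hy] : exists h : G j, (y, y') \in lab h.
  by apply: qcc_label_ex; rewrite ?(same_rel_fiber2 coh (qcc_fiberP j) xy).
by exists g, h; split=> //; apply: qcc_link_intro gx hy xy.
Qed.

Lemma qcc_linking : linking qcc_link.
Proof.
split=> [i j|i g h|i j g h|i j k g h].
- apply/group_setP; split=> [|[g h] [g' h'] /qcc_linkP lg /qcc_linkP lg'].
    have [[x Fx] [y Fy]] := (qcc_fiber_neq0 i, qcc_fiber_neq0 j).
    exact: qcc_link_intro (qcc_label1 Fx) (qcc_label1 Fy) (same_rel_refl coh _).
  have [[x Fx] [y Fy]] := (qcc_fiber_neq0 i, qcc_fiber_neq0 j).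
  have [x1 gx] := qcc_label_tot g Fx; have [y1 hy] := qcc_label_tot h Fy.
  have [x2 gx'] := qcc_label_tot g' (qcc_label_cod gx).
  have [y2 hy'] := qcc_label_tot h' (qcc_label_cod hy).
  apply: qcc_link_intro (qcc_label_mul gx gx') (qcc_label_mul hy hy') _.
  exact (same_rel_trans coh (lg _ _ _ _ gx hy) (lg' _ _ _ _ gx' hy')).
- have [x Fx] := qcc_fiber_neq0 i; have [y gx] := qcc_label_tot g Fx.
  apply/qcc_linkP/eqP=> [lg|<-].
    have [z hz] := qcc_label_tot h Fx.
    move/(same_rel_diag coh): (lg _ _ _ _ gx hz) => yz; rewrite -yz in hz.
    exact: qcc_label_uniq gx hz.
  apply/qcc_linkP; apply: (qcc_link_intro gx gx).
  have SF := qcc_fiberP i; rewrite inE in SF.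
  by rewrite -(same_rel_block coh _ SF) mem_diag_rel eqxx ?Fx ?(qcc_label_cod
    gx).
- move/qcc_linkP=> lg; apply/qcc_linkP=> x x' y y' hx gy.
  exact (same_rel_swap coh (lg _ _ _ _ gy hx)).
- have [[x Fx] [y Fy]] := (qcc_fiber_neq0 i, qcc_fiber_neq0 j).
  have [z Fz] := qcc_fiber_neq0 k.
  have [x' gx] := qcc_label_tot g Fx; have [y' hy] := qcc_label_tot h Fy.
  (* Lifting the path through [z] moves [z] to some [z']; the label of [(z, z')] is the middle
     element. *)
  move/qcc_linkP=> /(_ _ _ _ _ gx hy)/(same_rel_lift coh z)[z' xz zy].
  have [c cz] : exists c : G k, (z, z') \in lab c.
    by apply: qcc_label_ex; rewrite ?(same_rel_fiber coh (qcc_fiberP k) zy).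
  by exists c; [apply: qcc_link_intro gx cz xz | apply: qcc_link_intro cz hy
    zy].
Qed.

End Labels.

(** * Isomorphisms and homogeneous components *)

Lemma mem_map_rel (T T' : finType) (sigma : T -> T') (s : {set T * T}) x y :
  injective sigma -> ((sigma x, sigma y) \in map_rel sigma s) = ((x, y) \in s).
Proof.
move=> inj; rewrite (mem_imset (f := fun p =>
  (sigma p.1, sigma p.2)) _ (x, y)) //.
by move=> [a b] [c d] [/inj-> /inj->].
Qed.

Lemma map_rel_basis (T T' : finType) (S : {set {set T * T}})
    (S' : {set {set T' * T'}}) (sigma : T -> T') :
    coherent [set: T] S -> coherent [set: T'] S' -> bijective sigma ->
    (forall x y x' y', same_rel S (x, y) (x', y') =
       same_rel S' (sigma x, sigma y) (sigma x', sigma y')) ->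
  [set map_rel sigma s | s in S] = S'.
Proof.
move=> cS cS' [tau sK tK] same; have inj := can_inj sK.
have E s t x y : s \in S -> t \in S' -> (x, y) \in s ->
    (sigma x, sigma y) \in t -> map_rel sigma s = t.
  move=> Ss S't sxy txy; apply/setP=> -[a' b']; rewrite -(tK a') -(tK b').
  by rewrite mem_map_rel // (same_rel_block cS _ Ss sxy) same -(same_rel_block
    cS' _ S't txy).
apply/setP=> t; apply/imsetP/idP=> [[s Ss ->]|S't].
  case/and3P: (coherent_partition cS) => _ _ S0.
  have /set0Pn[[x y] sxy] : s != set0 by apply: contraNneq S0 => <-.
  by have [t' S't txy] := block_of cS' (sigma x, sigma y); rewrite (E s t' x y).
case/and3P: (coherent_partition cS') => _ _ S0.
have /set0Pn[[x' y'] txy] : t != set0 by apply: contraNneq S0 => <-.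
rewrite -(tK x') -(tK y') in txy.
have [s Ss sxy] := block_of cS (tau x', tau y').
by exists s => //; rewrite (E s t _ _ Ss S't sxy txy).
Qed.

Section Iso.

Variables (I : finType) (G : I -> finGroupType).
Hypothesis abelG : forall i, abelian [set: G i].

Lemma qcc_linkE (X : qcc_of_type G) i j (g : G i) (h : G j) x x' y y' :
    (x, x') \in qcc_label X g -> (y, y') \in qcc_label X h ->
  ((g, h) \in qcc_link X i j) = same_rel (qcc_basis X) (x, y) (x', y').
Proof.
move=> gx hy; apply/qcc_linkP/idP=> [lg|xy]; first exact: lg gx hy.
exact/qcc_linkP/(qcc_link_intro abelG gx hy xy).
Qed.

Lemma qcc_iso_link (X Y : qcc_of_type G) :
  qcc_iso X Y -> forall i j, qcc_link X i j = qcc_link Y i j.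
Proof.
case=> sigma [/bij_inj inj basis _ lab] i j; apply/setP=> -[g h].
have [[x Fx] [y Fy]] := (qcc_fiber_neq0 X i, qcc_fiber_neq0 X j).
have [x' gx] := qcc_label_tot g Fx; have [y' hy] := qcc_label_tot h Fy.
have gx' : (sigma x, sigma x') \in qcc_label Y g by rewrite -lab mem_map_rel.
have hy' : (sigma y, sigma y') \in qcc_label Y h by rewrite -lab mem_map_rel.
rewrite (qcc_linkE gx hy) (qcc_linkE gx' hy').
have [s Ss sxy] := block_of (qcc_coherent X) (x, y).
rewrite -(same_rel_block (qcc_coherent X) _ Ss sxy).
have S's : map_rel sigma s \in qcc_basis Y by rewrite -basis imset_f.
rewrite -(same_rel_block (s := map_rel sigma s) (qcc_coherent Y)) //.
  by rewrite mem_map_rel.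
by rewrite mem_map_rel.
Qed.

(** With base points [al i] and [be i], the isomorphism sends the point at label [g] from [al i] to
    the point at label [g] from [be i]. *)
Lemma qcc_link_iso (X Y : qcc_of_type G) :
  (forall i j, qcc_link X i j = qcc_link Y i j) -> qcc_iso X Y.
Proof.
move=> eqL.
have [al alF] := fin_all_exists (qcc_fiber_neq0 X).
have [be beF] := fin_all_exists (qcc_fiber_neq0 Y).
pose Q x y := exists i, exists g : G i,
  (al i, x) \in qcc_label X g /\ (be i, y) \in qcc_label Y g.
have Q1 x : exists y, Q x y.
  have [i Fx] := qcc_fiber_ex x; have [g gx] := qcc_label_ex (alF i) Fx.
  by have [y gy] := qcc_label_tot g (beF i); exists y, i, g.
have Q2 y : exists x, Q x y.
  have [i Fy] := qcc_fiber_ex y; have [g gy] := qcc_label_ex (beF i) Fy.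
  by have [x gx] := qcc_label_tot g (alF i); exists x, i, g.
have Qfiber x y i : Q x y -> (x \in qcc_fiber X i) = (y \in qcc_fiber Y i).
  case=> j [g [gx gy]]; have := qcc_label_cod gx; have := qcc_label_cod gy.
  move=> Fy Fx; apply/idP/idP.
    by move/(qcc_fiber_uniq Fx) => <-.
  by move/(qcc_fiber_uniq Fy) => <-.
have Qlab x y i : Q x y -> x \in qcc_fiber X i -> exists g : G i,
    (al i, x) \in qcc_label X g /\ (be i, y) \in qcc_label Y g.
  case=> j [g [gx gy]] Fx.
  (* Eliminating the equality of the two fiber indices moves [g] into [G i]. *)
  by case: _ / (qcc_fiber_uniq (qcc_label_cod gx) Fx); exists g.
have Qfun x y y' : Q x y -> Q x y' -> y = y'.
  case=> i [g [gx gy]] /Qlab-/(_ i (qcc_label_cod gx))[h [hx hy]].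
  by rewrite (qcc_label_uniq hx gx) in hy; apply: qcc_label_fun gy hy.
have Qinj x x' y : Q x y -> Q x' y -> x = x'.
  case=> i [g [gx gy]] Qx'; have := Qlab _ _ i Qx'.
  rewrite (Qfiber _ _ _ Qx') (qcc_label_cod gy) => /(_ isT)[h [hx hy]].
  by rewrite (qcc_label_uniq hy gy) in hx; apply: qcc_label_fun gx hx.
have [sigma sP] := fin_all_exists Q1; have [tau tP] := fin_all_exists Q2.
have sK : cancel sigma tau by move=> x; apply: Qinj (tP _) (sP _).
have tK : cancel tau sigma by move=> x; apply: Qfun (sP _) (tP _).
have inj := can_inj sK.
have sF x i : (sigma x \in qcc_fiber Y i) = (x \in qcc_fiber X i).
  by rewrite (Qfiber _ _ i (sP x)).
have lab1 i (g : G i) x x' : (x, x') \in qcc_label X g ->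
    (sigma x, sigma x') \in qcc_label Y g.
  move=> gx; have [a [ax ay]] := Qlab _ _ i (sP x) (qcc_label_dom gx).
  have [z gz] := qcc_label_tot g (qcc_label_cod ay).
  suff -> : sigma x' = z by [].
  apply: Qfun (sP x') _; exists i, (a * g).
  by split; [apply: qcc_label_mul ax gx | apply: qcc_label_mul ay gz].
have lab2 i (g : G i) x x' : (sigma x, sigma x') \in qcc_label Y g ->
    (x, x') \in qcc_label X g.
  move=> gx; have Fx := qcc_label_dom gx; have Fx' := qcc_label_cod gx.
  rewrite !sF in Fx Fx'; have [h hx] := qcc_label_ex Fx Fx'.
  by rewrite (qcc_label_uniq gx (lab1 _ _ _ _ hx)).
have same x y x' y' : same_rel (qcc_basis X) (x, y) (x', y') =
    same_rel (qcc_basis Y) (sigma x, sigma y) (sigma x', sigma y').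
  apply/idP/idP=> [xy|xy].
    have [[i Fx] [j Fy]] := (qcc_fiber_ex x, qcc_fiber_ex y).
    have [g [h [lg gx hy]]] := qcc_link_ex abelG Fx Fy xy.
    by rewrite -(qcc_linkE (lab1 _ _ _ _ gx) (lab1 _ _ _ _ hy)) -eqL.
  have [[i Fx] [j Fy]] := (qcc_fiber_ex (sigma x), qcc_fiber_ex (sigma y)).
  have [g [h [lg gx hy]]] := qcc_link_ex abelG Fx Fy xy.
  by rewrite -(qcc_linkE (lab2 _ _ _ _ gx) (lab2 _ _ _ _ hy)) eqL.
have bij : bijective sigma by exists tau.
exists sigma; split=> // [|i|i g].
- exact: map_rel_basis (qcc_coherent X) (qcc_coherent Y) bij same.
- apply/setP=> y; rewrite -(tK y) sF; apply/imsetP/idP=> [[x Fx /inj->//]|Fx].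
  by exists (tau y).
- apply/setP=> -[x y]; rewrite -(tK x) -(tK y) mem_map_rel //.
  by apply/idP/idP; [apply: lab1 | apply: lab2].
Qed.

End Iso.

(** * Homogeneous components *)

Lemma mem_fiber_diag (T : finType) (D : {set T}) x :
  (x \in D) = ((x, x) \in diag_rel D).
Proof. by rewrite mem_diag_rel eqxx andbT. Qed.

Section HomComponent.

Variables (T : finType) (S : {set {set T * T}}) (D : {set T}).
Hypotheses (cohS : coherent [set: T] S) (SD : D \in fibers S).

Lemma hom_component_mem s x y : s \in S -> (x, y) \in s -> x \in D -> y \in D ->
  s \in hom_component S D.
Proof.
move=> Ss sxy Dx Dy; rewrite inE Ss; apply/subsetP=> -[x' y'].
rewrite (same_rel_block cohS _ Ss sxy) => xy.
by rewrite inE /= (same_rel_fiber cohS SD xy) Dx (same_rel_fiber2 cohS SD xy).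
Qed.

Lemma coherent_hom_component : coherent D (hom_component S D).
Proof.
have SdD : diag_rel D \in S by move: SD; rewrite inE.
case/and3P: (coherent_partition cohS) => _ tiS S0; split.
- apply/and3P; split.
  + apply/eqP/setP=> -[x y]; apply/bigcupP/idP=> [[s]|].
      by rewrite inE => /andP[_ /subsetP]; apply.
    rewrite inE /= => /andP[Dx Dy]; have [s Ss sxy] := block_of cohS (x, y).
    by exists s => //; apply: hom_component_mem sxy Dx Dy.
  + apply: trivIsetS tiS; apply/subsetP=> s; by rewrite inE => /andP[].
  + by apply: contra S0; rewrite inE => /andP[].
- exists [set diag_rel D]; split.
    apply/subsetP=> s /set1P->; rewrite inE SdD; apply/subsetP=> -[x y].
    by rewrite mem_diag_rel inE /= => /andP[Dx /eqP<-]; rewrite Dx.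
  by rewrite /cover big_set1.
- move=> s; rewrite inE => /andP[Ss /subsetP sD];
  rewrite inE (coherent_conv cohS Ss).
  by apply/subsetP=> -[x y]; rewrite mem_conv_rel => /sD; rewrite !inE andbC.
- move=> r s t; rewrite !inE => /andP[Sr _] /andP[Ss _] /andP[St _].
  exact (coherent_intersection cohS Sr Ss St).
Qed.

(** A fiber of the component shares a diagonal pair with [D], and basis relations that meet
    coincide. *)
Lemma card_fibers_hom_component : #|fibers (hom_component S D)| = 1%N.
Proof.
have SdD : diag_rel D \in S by move: SD; rewrite inE.
suff -> : fibers (hom_component S D) = [set D] by rewrite cards1.
apply/setP=> E; rewrite !inE; apply/andP/eqP=> [[SE /subsetP ED]|->];
  last first.
  split=> //; apply/subsetP=> -[x y].
  by rewrite mem_diag_rel inE /= => /andP[Dx /eqP<-]; rewrite Dx.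
case/and3P: (coherent_partition cohS) => _ _ S0.
have /set0Pn[[x y] Exy] : diag_rel E != set0 by apply: contraNneq S0 => <-.
have := Exy; rewrite mem_diag_rel => /andP[_ /eqP xy]; rewrite -xy in Exy.
have := ED _ Exy; rewrite inE /= => /andP[Dx _]; rewrite mem_fiber_diag in Dx.
by apply/setP=> z; rewrite (mem_fiber_diag E) (mem_fiber_diag D)
  (same_rel_block cohS _ SE Exy) (same_rel_block cohS _ SdD Dx).
Qed.

End HomComponent.

(** * The configuration of a linked family *)

Section Model.

Variables (I : finType) (G : I -> finGroupType).
Hypothesis abelG : forall i, abelian [set: G i].
Variable L : forall i j, {set G i * G j}.
Hypothesis linkL : linking L.

Definition model_point : finType := {i : I & G i}.
Local Notation pt := (@Tagged I _ G).

(** Right translation by [L]: the classes are the left cosets of [L i j] in the product of [G i] and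
    [G j]. *)
Definition model_rel (p q : model_point * model_point) :=
  [exists gh in L (tag p.1) (tag p.2),
    q == (pt (tagged p.1 * gh.1), pt (tagged p.2 * gh.2))].

Lemma model_relP i j (a : G i) (c : G j) q : reflect
  (exists g h, (g, h) \in L i j /\ q = (pt (a * g), pt (c * h)))
  (model_rel (pt a, pt c) q).
Proof.
apply: (iffP exists_inP) => [[[g h] lg /eqP->]|[g [h [lg ->]]]].
  by exists g, h.
by exists (g, h).
Qed.

Lemma pt_inj i : injective (fun a : G i => pt a).
Proof. by move=> a c /eqP; rewrite eq_Tagged => /eqP. Qed.

Lemma model_rel_pt i j (a a' : G i) (c c' : G j) :
  model_rel (pt a, pt c) (pt a', pt c') = ((a^-1 * a', c^-1 * c') \in L i j).
Proof.
apply/model_relP/idP=> [[g [h [lg [/pt_inj-> /pt_inj->]]]]|lg].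
  by rewrite !mulKg.
by exists (a^-1 * a'), (c^-1 * c'); rewrite !mulKVg.
Qed.

Lemma model_rel_refl p : model_rel p p.
Proof.
case: p => [[i a] [j c]]; apply/(@model_relP i j a c); exists 1, 1.
by rewrite !mulg1 (group1 (Group (link_group linkL i j))).
Qed.

Lemma model_rel_eq p q : model_rel p q -> model_rel p =1 model_rel q.
Proof.
case: p => [[i a] [j c]] /(@model_relP i j a c)[g [h [lg ->]]] r.
pose K := Group (link_group linkL i j).
apply/(@model_relP i j a c)/model_relP=> -[g' [h' [lg' ->]]].
  exists (g^-1 * g'), (h^-1 * h'); split; last by rewrite !mulgA !mulgK.
  exact: (groupM (G := K) (groupVr (G := K) lg) lg').
exists (g * g'), (h * h'); split; last by rewrite !mulgA.
exact: (groupM (G := K) lg lg').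
Qed.

Lemma model_rel_sym p q : model_rel p q = model_rel q p.
Proof.
by apply/idP/idP=> /model_rel_eq/[dup] e; rewrite -?e ?model_rel_refl.
Qed.

Lemma model_rel_equiv :
  {in [set: model_point * model_point] & &, equivalence_rel model_rel}.
Proof.
by move=> p q r _ _ _; split=> [|/model_rel_eq]; first exact: model_rel_refl.
Qed.

Definition model_basis : {set {set model_point * model_point}} :=
  equivalence_partition model_rel [set: model_point * model_point].

Lemma model_same_rel p q : same_rel model_basis p q = model_rel p q.
Proof.
by rewrite /same_rel pblock_equivalence_partition ?inE //;
  apply: model_rel_equiv.
Qed.

Lemma model_basisP s : reflect (exists p,
  s = [set q | model_rel p q]) (s \in model_basis).
Proof.
apply: (iffP imsetP) => [[p _ ->]|[p ->]]; exists p; rewrite ?inE //.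
  by apply/setP=> q; rewrite !inE.
by apply/setP=> q; rewrite !inE.
Qed.

Definition model_label i (g : G i) : {set model_point * model_point} :=
  [set q | model_rel (pt (1 : G i), pt g) q].

(** As [L i i] is the diagonal, the class of [(1, g)] consists of the pairs [(a, g * a)];
    commutativity rewrites them as [(a, a * g)]. *)
Lemma model_labelP i (g : G i) x y : reflect
  (exists a, x = pt a /\ y = pt (a * g)) ((x, y) \in model_label g).
Proof.
have cG : forall a c : G i, a * c = c * a.
  by move=> a c; apply: (centsP (abelG i)); rewrite inE.
rewrite inE; apply: (iffP (model_relP _ _ _)) =>
  [[a [c [lac [-> ->]]]]|[a [-> ->]]].
  by move: lac; rewrite (link_diag linkL) => /eqP<-; exists a; rewrite mul1g cG.
by exists a, a; rewrite (link_diag linkL) eqxx mul1g cG.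
Qed.

Lemma model_rel_swap x y x' y' : model_rel (x, y) (x', y') -> model_rel (y,
  x) (y', x').
Proof.
case: x y => [i a] [j c] /(@model_relP i j a c)[g [h [/(link_sym linkL) lg [->
  ->]]]].
by apply/(@model_relP j i c a); exists h, g.
Qed.

Definition model_fiber (i : I) : {set model_point} := [set x | tag x == i].

Lemma model_fiberP i x : reflect (exists a :
  G i, x = pt a) (x \in model_fiber i).
Proof.
rewrite inE; apply: (iffP eqP) => [<-|[a ->] //].
by exists (tagged x); case: x.
Qed.

Lemma model_label1 i : model_label (1 : G i) = diag_rel (model_fiber i).
Proof.
apply/setP=> -[x y]; rewrite mem_diag_rel.
apply/model_labelP/andP=> [[a [-> ->]]|[/model_fiberP[a ->] /eqP<-]].
  by rewrite mulg1 inE !eqxx.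
by exists a; rewrite mulg1.
Qed.

Lemma model_label_basis i (g : G i) : model_label g \in model_basis.
Proof. by apply/model_basisP; exists (pt (1 : G i), pt g). Qed.

Lemma model_rel_label i (a c : G i) :
  [set q | model_rel (pt a, pt c) q] = model_label (a^-1 * c).
Proof.
have e: model_rel (pt (1 : G i), pt (a^-1 * c)) (pt a, pt c).
  have: (pt a, pt c) \in model_label (a^-1 * c).
    by apply/model_labelP; exists a; rewrite mulKVg.
  by rewrite inE.
apply/setP=> q; rewrite !inE.
by rewrite (model_rel_eq e).
Qed.

Lemma model_partition : partition model_basis (setX [set: model_point] [set:
  model_point]).
Proof.
have -> : setX [set: model_point] [set: model_point] =
  [set: model_point * model_point].
  by apply/setP=> p; rewrite !inE.
exact: equivalence_partitionP model_rel_equiv.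
Qed.

(* If g, h are linked and f k links them through the fiber k, translating the
   fiber k by f k carries the paths counted at p to paths counted at q. *)
Lemma model_int_leq r s (p q : model_point * model_point) :
    r \in model_basis -> s \in model_basis -> model_rel p q ->
  #|nbrs r p.1 :&: nbrs (conv_rel s) p.2| <= #|nbrs r q.1 :&: nbrs (conv_rel s)
    q.2|.
Proof.
move=> /model_basisP[r0 ->] /model_basisP[s0 ->].
case: p => [[i a] [j c]] /(@model_relP i j a c)[g [h [lg ->]]] /=.
have [f fP] : exists f : forall k, G k,
    forall k, (g, f k) \in L i k /\ (f k, h) \in L k j.
  apply: (@fin_all_exists I (fun k => G k :
    Type) (fun k d => (g, d) \in L i k /\ (d, h) \in L k j)) => k.
  by have [d ? ?] := link_comp linkL k lg; exists d.
pose F (z : model_point) : model_point := pt (tagged z * f (tag z)).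
pose F' (z : model_point) : model_point := pt (tagged z * (f (tag z))^-1).
have /can_inj Finj : cancel F F' by case=> k d; rewrite /F /F' /= mulgK.
rewrite -(card_imset _ Finj); apply/subset_leq_card/subsetP=> _ /imsetP[[k d] +
  ->].
rewrite !inE !mem_conv_rel !inE => /andP[rz sz]; apply/andP; split.
  have e : model_rel (pt a, pt d) (pt (a * g), pt (d * f k)).
    by apply/model_relP; exists g, (f k); have [] := fP k.
  by rewrite model_rel_sym -(model_rel_eq e) model_rel_sym.
have e : model_rel (pt d, pt c) (pt (d * f k), pt (c * h)).
  by apply/model_relP; exists (f k), h; have [] := fP k.
by rewrite model_rel_sym -(model_rel_eq e) model_rel_sym.
Qed.

Lemma model_coherent : coherent [set: model_point] model_basis.
Proof.
split; first exact: model_partition.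
- exists [set s in model_basis | s \subset diag_rel [set: model_point]]; split.
    by apply/subsetP=> s; rewrite inE => /andP[].
  apply/setP=> p; apply/idP/bigcupP=> [|[s]]; last first.
    by rewrite inE => /andP[_ /subsetP]; apply.
  case: p => x y; rewrite mem_diag_rel => /andP[_ /eqP<-].
  exists (model_label (1 : G (tag x))).
    rewrite inE model_label_basis model_label1; apply/subsetP=> -[z w].
    by rewrite !mem_diag_rel => /andP[_ ->]; rewrite inE.
  by rewrite model_label1 mem_diag_rel inE !eqxx.
- move=> s /model_basisP[[x y] ->]; apply/model_basisP; exists (y, x).
  apply/setP=> -[z w]; rewrite mem_conv_rel !inE.
  by apply/idP/idP=> /model_rel_swap.
- move=> r s t Sr Ss /model_basisP[p0 ->] p q; rewrite !inE => p0p p0q.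
  have pq : model_rel p q by rewrite -(model_rel_eq p0p).
  (* Symmetry of [model_rel] supplies the second inequality. *)
  by apply/eqP; rewrite eqn_leq !model_int_leq // model_rel_sym.
Qed.

Lemma model_fibers : [set model_fiber i | i : I] = fibers model_basis.
Proof.
apply/setP=> D; apply/imsetP/idP=> [[i _ ->]|].
  by rewrite inE -model_label1 model_label_basis.
rewrite inE => /model_basisP[[x y] defD]; exists (tag x) => //.
have: (x, y) \in diag_rel D by rewrite defD inE model_rel_refl.
rewrite mem_diag_rel => /andP[_ /eqP xy]; rewrite -{}xy in defD.
apply/setP=> z; rewrite (mem_fiber_diag D) (mem_fiber_diag (model_fiber _)).
rewrite defD -model_label1; case: x {defD} => i a.
by rewrite (model_rel_label a a) mulVg.
Qed.

Lemma model_label_im i : [set model_label g | g : G i] =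
  hom_component model_basis (model_fiber i).
Proof.
have Fi : model_fiber i \in fibers model_basis by rewrite -model_fibers imset_f.
apply/setP=> s; apply/imsetP/idP=> [[g _ ->]|].
  apply: (hom_component_mem model_coherent Fi (x := pt (1 : G i)) (y := pt g)).
  - exact: model_label_basis.
  - by rewrite inE model_rel_refl.
  - by apply/model_fiberP; exists 1.
  - by apply/model_fiberP; exists g.
rewrite inE => /andP[/model_basisP[[x y] ->] /subsetP sF].
have /sF/setXP[] : (x, y) \in [set q | model_rel (x, y) q].
  by rewrite inE model_rel_refl.
move=> /model_fiberP[a ->] /model_fiberP[c ->].
by exists (a^-1 * c) => //; apply: model_rel_label.
Qed.

Lemma model_label_thin i (g : G i) : thin (model_label g).
Proof.
move=> x; split; apply/card_le1_eqP=> y z; rewrite !inE ?mem_conv_rel.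
  rewrite -!in_set => /model_labelP[a [-> ->]] /model_labelP[c [/pt_inj<- ->]]
    //.
move=> /model_labelP[a [-> ->]] /model_labelP[c [-> /pt_inj/mulIg->]] //.
Qed.

Lemma model_labelM i (g h : G i) :
  model_label (g * h) = comp_rel (model_label g) (model_label h).
Proof.
apply/setP=> -[x y]; rewrite [RHS]inE; apply/model_labelP/existsP=> /=.
  case=> a [-> ->]; exists (pt (a * g)); apply/andP; split; apply/model_labelP.
    by exists a.
  by exists (a * g); rewrite mulgA.
case=> z /andP[/model_labelP[a [-> ->]] /model_labelP[c [/pt_inj<- ->]]].
by exists a; rewrite mulgA.
Qed.

Lemma model_quasiregular : quasiregular model_basis.
Proof.
split=> [|D FD]; first exact: model_coherent.
split; first exact: coherent_hom_component model_coherent FD.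
  exact: card_fibers_hom_component model_coherent FD.
move: FD; rewrite -model_fibers => /imsetP[i _ ->] s.
by rewrite -model_label_im => /imsetP[g _ ->]; apply: model_label_thin.
Qed.

Lemma model_fiber_inj : injective model_fiber.
Proof.
move=> i j /setP/(_ (pt (1 : G i))); rewrite !inE eqxx.
by move/esym/eqP.
Qed.

Lemma model_label_inj i : injective (@model_label i).
Proof.
move=> g h eqgh; have: (pt (1 : G i), pt g) \in model_label h.
  by rewrite -eqgh; apply/model_labelP; exists 1; rewrite mul1g.
by case/model_labelP=> a [/pt_inj<- /pt_inj->]; rewrite mul1g.
Qed.

Definition model : qcc_of_type G :=
  QccOfType model_quasiregular model_fiber_inj model_fibers model_label_inj
    model_label_im model_labelM.

(** It suffices to compare at the identities, where [(g, h)] translates [(1, 1)] to [(g, h)]. *)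
Lemma model_link i j : qcc_link model i j = L i j.
Proof.
apply/setP=> -[g h].
rewrite (qcc_linkE (X := model) (x := pt (1 : G i)) (x' := pt g)
   (y := pt (1 : G j)) (y' := pt h) abelG) /=.
- by rewrite model_same_rel model_rel_pt !invg1 !mul1g.
- by rewrite inE model_rel_refl.
- by rewrite inE model_rel_refl.
Qed.

End Model.

(** * Schurity and amalgams *)

Section Schurian.

Variables (I : finType) (G : I -> finGroupType).
Hypothesis abelG : forall i, abelian [set: G i].

(** A family [u] compatible with all [L k l] translates each fiber [k] by [u k] and preserves the
    basis relations; the condition says that these families project onto every [L i j]. *)
Definition extends (L : forall i j, {set G i * G j}) : Prop :=
  forall i j (g : G i) (h : G j), (g, h) \in L i j ->
  exists u : {dffun forall i, G i},
    [/\ forall k l, (u k, u l) \in L k l, u i = g & u j = h].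

(** An element of [K] realizing [(g, h)] on base points moves every base point by some label, and
    these labels form the family. *)
Lemma schurian_extends (X : qcc_of_type G) :
  schurian (qcc_basis X) -> extends (qcc_link X).
Proof.
case=> K defS i j g h lgh; have coh := qcc_coherent X.
have orbP p q : same_rel (qcc_basis X) p q = (q \in pair_orbit K p).
  rewrite -(same_rel_block coh (s := pair_orbit K p)) //;
    first by rewrite defS imset_f.
  by apply/imsetP; exists 1; rewrite ?group1 // !perm1; case: p.
have [al alF] := fin_all_exists (qcc_fiber_neq0 X).
have [x gx] := qcc_label_tot g (alF i); have [y hy] := qcc_label_tot h (alF j).
have := qcc_linkE abelG gx hy; rewrite lgh orbP => /esym/imsetP[k Kk [ex ey]].
have same z w : same_rel (qcc_basis X) (z, w) (k z, k w).
  by rewrite orbP; apply/imsetP; exists k.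
have [f fP] : exists f : forall l, G l,
    forall l, (al l, k (al l)) \in qcc_label X (f l).
  apply: (@fin_all_exists I (fun l => G l : Type)
    (fun l d => (al l, k (al l)) \in qcc_label X d)) => l.
  apply: qcc_label_ex => //.
  by rewrite (same_rel_fiber coh (qcc_fiberP X l) (same _ (al l))).
exists (finfun f); split=> [l m||]; rewrite ?ffunE.
- exact: (qcc_link_intro abelG (fP l) (fP m) (same _ _)).
- by apply: qcc_label_uniq (fP i) _; rewrite -ex.
- by apply: qcc_label_uniq (fP j) _; rewrite -ey.
Qed.

(** The group is the full stabilizer of the basis relations; the family extending [(g, h)]
    translates every fiber and gives the permutation required. *)
Lemma extends_schurian (X : qcc_of_type G) :
  extends (qcc_link X) -> schurian (qcc_basis X).
Proof.
move=> ext; have coh := qcc_coherent X; pose T := qcc_point X.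
pose K := [set p : {perm T} |
  [forall x, forall y, same_rel (qcc_basis X) (x, y) (p x, p y)]].
have KP (p : {perm T}) : reflect (forall x y, same_rel (qcc_basis X) (x,
  y) (p x, p y)) (p \in K).
  by rewrite inE; apply: (iffP forallP) => [Kp x y|Kp x];
    [have/forallP := Kp x | apply/forallP].
have KG : group_set K.
  apply/group_setP; split=> [|p q /KP Kp /KP Kq]; apply/KP=> x y.
    by rewrite !perm1 same_rel_refl.
  by rewrite !permM (same_rel_trans coh (Kp x y)).
have orbP p q : same_rel (qcc_basis X) p q = (q \in pair_orbit (Group KG) p).
  case: p => x y; apply/idP/imsetP=> [|[k /KP Kk ->]]; last exact: Kk.
  case: q => x' y'; have [[i Fx] [j Fy]] := (qcc_fiber_ex x, qcc_fiber_ex y).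
  case/(qcc_link_ex abelG Fx Fy)=> g [h [/ext[u [uL <- <-]] gx hy]].
  have [s sP] : exists s : T -> T,
      forall z, exists l, (z, s z) \in qcc_label X (u l).
    apply: (@fin_all_exists T (fun=> T : Type)
      (fun z w => exists l, (z, w) \in qcc_label X (u l))) => z.
    have [l Fz] := qcc_fiber_ex z; have [w uw] := qcc_label_tot (u l) Fz.
    by exists w, l.
  have sE z w l : (z, w) \in qcc_label X (u l) -> s z = w.
    move=> uz; have [m uz'] := sP z.
    have elm := qcc_fiber_uniq (qcc_label_dom uz) (qcc_label_dom uz').
    by case: _ / elm uz' => uz'; apply: qcc_label_fun uz' uz.
  have same z w : same_rel (qcc_basis X) (z, w) (s z, s w).
    have [[l uz] [m uw]] := (sP z, sP w).
    by have /qcc_linkP := uL l m; apply.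
  (* Two points with equal images form a pair in the basis relation of a diagonal pair, so they are
     equal. *)
  have sI : injective s.
    move=> z w eqs; have := same z w; rewrite eqs (same_rel_sym coh).
    by move/(same_rel_diag coh).
  exists (perm sI); last by rewrite !permE /= (sE _ _ _ gx) (sE _ _ _ hy).
  by apply/KP=> z w; rewrite !permE.
exists (Group KG); apply/setP=> s; apply/idP/imsetP=> [Ss|[p _ ->]].
  case/and3P: (coherent_partition coh) => _ _ S0.
  have /set0Pn[p sp] : s != set0 by apply: contraNneq S0 => <-.
  by exists p => //; apply/setP=> q; rewrite (same_rel_block coh _ Ss sp).
have [t St tp] := block_of coh p; suff <- : t = pair_orbit (Group KG) p by [].
by apply/setP=> q; rewrite (same_rel_block coh _ St tp).
Qed.

(** * Amalgams and the complement of the relators *)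

Lemma abelian_dffun : abelian [set: {dffun forall i, G i}].
Proof.
apply/centsP=> u _ v _; apply/ffunP=> i; rewrite !ffunE.
by apply: (centsP (abelG i)); rewrite inE.
Qed.

Lemma am_pi_eq (A : amalgam_configuration G) i j (x : G i) (y : G j) : reflect
  (am_pi A x = am_pi A y) ((dfung1 x)^-1 * dfung1 y \in am_U0 A).
Proof.
have nU u : u \in 'N(am_U0 A).
  exact: (subsetP (sub_abelian_norm abelian_dffun (subsetT _))) (in_setT u).
apply: (iffP idP) => [xy|/esym].
  apply/esym/rcoset_kercosetP; rewrite ?nU // mem_rcoset.
  by rewrite (centsP abelian_dffun _ _ (dfung1 x)^-1) ?inE.
move/rcoset_kercosetP; rewrite !nU mem_rcoset => /(_ isT isT).
by rewrite (centsP abelian_dffun _ _ (dfung1 x)^-1) ?inE.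
Qed.

Lemma relator_mem (A : amalgam_configuration G) i j (x : G i) (y : G j) :
  (x, y) \in am_graph A i j -> (dfung1 x)^-1 * dfung1 y \in am_U0 A.
Proof.
case/am_graphP=> Ux <-; apply: mem_gen; apply/bigcupP; exists i => //.
by apply/bigcupP; exists j => //; apply: imset_f.
Qed.

(** The case [i = j] is injectivity of [am_pi]; in general, images coincide only through f_ij, which
    is the intersection condition. *)
Lemma admits_amalgamE (A : amalgam_configuration G) : admits_amalgam A <->
  forall i j (x : G i) (y : G j),
    (dfung1 x)^-1 * dfung1 y \in am_U0 A -> (x, y) \in am_graph A i j.
Proof.
have gA := am_graph_system A.
split=> [[inj cap] i j x y /am_pi_eq pixy|adm].
  have: am_pi A x \in (@am_pi _ _ A i @: [set: G i]) :&: (@am_pi _ _ A j @: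
    [set: G j]).
    by rewrite inE imset_f ?inE // pixy imset_f ?inE.
  rewrite cap => /imsetP[x' Ux' /inj eqx]; rewrite -{x'}eqx in Ux'.
  apply/am_graphP; split=> //; apply: (inj j); rewrite -pixy.
  by apply/esym/am_pi_eq/relator_mem/am_graphP.
split=> [i x y /am_pi_eq/adm|i j].
  by rewrite (graph_diag gA) => /eqP.
apply/setP=> c; apply/setIP/imsetP=> [[/imsetP[x _ ->] /imsetP[y _]]|[x Ux ->]].
  by move/am_pi_eq/adm/am_graphP=> [Ux _]; exists x.
split; first by rewrite imset_f ?inE.
have -> : am_pi A x = am_pi A (am_f A i j x).
  by apply/am_pi_eq/relator_mem/am_graphP.
by rewrite imset_f ?inE.
Qed.

Variable b : forall i, G i -> G i -> algC.
Arguments b : clear implicits.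
Hypothesis bP : forall i, pairing [set: G i] (b i).

Let bU (u v : {dffun forall i, G i}) := (\prod_i b i (u i) (v i))%R.
Let bUP : pairing _ bU := pairing_dffun bP.

Lemma pair_relator i j (x : G i) (y : G j) u :
  (bU ((dfung1 x)^-1 * dfung1 y) u == 1%R) = (b i x (u i) == b j y (u j)).
Proof.
rewrite (pairM bUP) (pairV bUP) /bU !(pair_dfung1 _ _ bP).
rewrite -(inj_eq (mulfI (pair_neq0 (bP i) x (u i)))).
by rewrite mulrA divff ?(pair_neq0 (bP i)) // mul1r mulr1 eq_sym.
Qed.

(** Orthogonality to [am_U0 A] need only be tested on the relators, where [pair_relator] turns it
    into orthogonality to the graphs. *)
Lemma perp_am_U0 (A : amalgam_configuration G) (u : {dffun forall i, G i}) :
  reflect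
  (forall i j, (u i, u j) \in perp2 b (am_graph A) i j) (u \in
    perp bU (am_U0 A)).
Proof.
rewrite (perp_gen bUP); apply: (iffP (perpP _ _ _)) => [Au i j|Au r].
  apply/(perp2P bP)=> x y /am_graphP[Ux <-].
  rewrite !(pairC (bP _) (u _)); apply/eqP;
    rewrite -pair_relator (pairC bUP) Au //.
  apply/bigcupP; exists i => //; apply/bigcupP; exists j => //.
  exact: imset_f.
case/bigcupP=> i _ /bigcupP[j _ /imsetP[x Ux ->]].
rewrite (pairC bUP); apply/eqP; rewrite pair_relator.
rewrite -!(pairC (bP _) (u _)); apply/eqP.
by have /(perp2P bP) := Au i j; apply; apply/am_graphP.
Qed.

Lemma extends_admits (L : forall i j, {set G i * G j}) (A :
  amalgam_configuration G) :
    linking L -> (forall i j, am_graph A i j = perp2 b L i j) ->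
  extends L <-> admits_amalgam A.
Proof.
move=> linkL gA; apply: (iff_trans _ (iff_sym (admits_amalgamE A))).
have perpA i j : perp2 b (am_graph A) i j = L i j.
  by rewrite /perp2 gA; apply: (perp2K bP (link_group linkL i j)).
split=> [ext i j x y U0xy|adm i j g h lgh].
  (* Every element of [L i j] comes from some [u] orthogonal to [am_U0 A], hence to the given
     element of it. *)
  rewrite gA; apply/(perp2P bP) => g h /ext[u [uL <- <-]].
  have /perpP uP : u \in perp bU (am_U0 A).
    by apply/perp_am_U0=> k l; rewrite perpA.
  by apply/eqP; rewrite -pair_relator (pairC bUP) uP.
pose K := Group (group_set_perp bUP (am_U0 A)).
pose P := [set (u i, u j) | u : {dffun forall i, G i} in K].
have PG : group_set P.
  apply/group_setP; split=> [|_ _ /imsetP[u Ku ->] /imsetP[v Kv ->]].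
    by apply/imsetP; exists 1; rewrite ?group1 // !ffunE.
  by apply/imsetP; exists (u * v); rewrite ?groupM // !ffunE.
have [/imsetP[u /perp_am_U0 Ku [-> ->]]|nP] := boolP ((g, h) \in P).
  by exists u; split=> // k l; rewrite -perpA.
(* Some [(x, y)] is orthogonal to [P] but not to [(g, h)]. By biduality its relator lies in
   [am_U0 A], so [adm] makes it orthogonal to [(g, h)] after all. *)
have [[x y] xyP] := perp_separates (pairing2 bP i j) (H := Group PG) nP.
rewrite (pair2_eq1 bP) => /negP[]; apply/eqP.
have /adm : (dfung1 x)^-1 * dfung1 y \in am_U0 A.
  rewrite -(perpK bUP); apply/perpP=> u Ku; apply/eqP; rewrite pair_relator.
  rewrite -(pair2_eq1 bP); apply/eqP/(perpP _ _ _ xyP).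
  exact: imset_f.
by rewrite gA => /(perp2P bP); apply.
Qed.

End Schurian.

(** * The correspondence *)

Theorem theorem1p1 (I : finType) (G : I -> finGroupType)
    (abelG : forall i : I, abelian [set: G i]) :
  exists Phi : qcc_of_type G -> amalgam_configuration G,
    [/\ forall X Y : qcc_of_type G, am_eq (Phi X) (Phi Y) <-> qcc_iso X Y,
        forall A : amalgam_configuration G,
          exists X : qcc_of_type G, am_eq (Phi X) A
      & forall X : qcc_of_type G,
          schurian (qcc_basis X) <-> admits_amalgam (Phi X)].
Proof.
pose b i := sval (pairing_exists (abelG i)).
have bP i : pairing [set: G i] (b i) := svalP (pairing_exists (abelG i)).
pose Phi (X : qcc_of_type G) : amalgam_configuration G :=
  sval (amalgam_of_graph (perp_linking bP (qcc_linking X abelG))).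
have PhiP X i j : am_graph (Phi X) i j = perp2 b (qcc_link X) i j.
  exact: (svalP (amalgam_of_graph (perp_linking bP (qcc_linking X abelG)))).
(* Biduality recovers the linked subgroups from the graphs, which gives injectivity up to
   isomorphism. *)
have perpK2 (L : forall i j, {set G i * G j}) M i j :
    (forall i j, group_set (L i j)) -> (forall i j, M i j = perp2 b L i j) ->
    perp2 b M i j = L i j.
  by move=> gL eM; rewrite /perp2 eM; apply: (perp2K bP).
exists Phi; split=> [X Y|A|X].
- apply: (iff_trans (am_eq_graph _ _)); split=> [eqG|/(qcc_iso_link abelG) eqL
  i j].
    apply: (qcc_link_iso abelG) => i j.
    have := link_group (qcc_linking X abelG);
      have := link_group (qcc_linking Y abelG).
    move=> gY gX; rewrite -(perpK2 _ (am_graph (Phi Y)) i j gY) => [|k l];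
      last exact: PhiP.
    by rewrite -(perpK2 _ (am_graph (Phi Y)) i j gX) => // k l;
      rewrite -eqG PhiP.
  by rewrite !PhiP /perp2 eqL.
- have gA := am_graph_system A.
  pose linkL := perp_graph_system bP abelG gA.
  (* The preimage of [A] is the model of the complements of its graphs. *)
  exists (model abelG linkL); apply/am_eq_graph => i j; rewrite PhiP.
  apply: perpK2 => [|k l]; first exact: graph_group gA.
  exact: model_link.
- apply: iff_trans (extends_admits abelG bP (qcc_linking X abelG) (PhiP X)).
  split; [exact: schurian_extends | exact: extends_schurian].
Qed.
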